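(* For every positive integer $n$ and every $\epsilon\in(0,1)$ there is a constant $c_{n,\epsilon}>0$, depending only on $n$ and $\epsilon$, such that the following holds. Let $I\subset\mathbb{R}$ be an open interval (possibly infinite), $K\subset I$ a closed set, and $\mu$ a regular probability measure supported on $K$. Then there exists a closed set $E\subset I$ with at most $n$ connected components such that $\mu(E)\ge 1-\epsilon$ and $$\int|f(t)|\,d\mu(t)\;\ge\; c_{n,\epsilon}\,C^{-1}\sup_{t\in E}|f(t)|$$ for every $C\ge1$ and every function $f$ which is of polynomial type $n$ on $(K_\epsilon,I)$ with constant $C$ (in particular $E$ does not depend on $f$ or $C$).
   Context: For a closed set $K$ contained in an open interval $I$ and $\epsilon\in(0,1)$, $K_\epsilon:=K\cup K_R\cup K_L$, where $K_R$ and $K_L$ consist of points $t\in I$ that are bounded on both sides by $K$ (that is, $K$ contains a point $\le t$ and a point $\ge t$) and satisfy respectively $$K_R:\ \inf\{d\ge0: t+d\in K\}\le\epsilon\,\inf\{d\ge0:t-d\in K\},\qquad K_L:\ \inf\{d\ge0: t-d\in K\}\le\epsilon\,\inf\{d\ge0:t+d\in K\}.$$ For a set $S\subset I$ and a nonnegative integer $n$, a function $f\in C^n(I)$ is of polynomial type $n$ on $(S,I)$ with constant $C$ if $f^{(n)}$ does not change sign on $I$ (it is everywhere nonnegative or everywhere nonpositive) and $\sup_{t\in I}|f^{(n)}(t)|\le C\inf_{t\in S}|f^{(n)}(t)|$ with $C$ finite. *)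

(* Defs.v *)
From HB Require Import structures.
From mathcomp Require Import all_boot all_order all_algebra.
From mathcomp Require Import all_classical all_reals all_analysis.

Set Implicit Arguments.
Unset Strict Implicit.
Unset Printing Implicit Defensive.

Import Order.TTheory GRing.Theory Num.Theory.
Import numFieldNormedType.Exports.

Local Open Scope classical_set_scope.
Local Open Scope card_scope.
Local Open Scope ring_scope.

Definition open_interval (R : realType) (I : set R) : Prop :=
  open I /\ is_interval I.

(* The index sets below are nonempty exactly when K has a point >= t
   (resp. <= t), so [inf] only takes its default value 0 outside the range in
   which these distances are used. *)
Definition rdist (R : realType) (K : set R) (t : R) : R :=
  inf [set d | 0 <= d /\ K (t + d)].

Definition ldist (R : realType) (K : set R) (t : R) : R :=
  inf [set d | 0 <= d /\ K (t - d)].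

Definition two_sided (R : realType) (K : set R) (t : R) : Prop :=
  (exists2 a, K a & a <= t) /\ (exists2 b, K b & t <= b).

Definition right_enlargement (R : realType) (I K : set R) (eps : R) : set R :=
  [set t | [/\ I t, two_sided K t & rdist K t <= eps * ldist K t]].

Definition left_enlargement (R : realType) (I K : set R) (eps : R) : set R :=
  [set t | [/\ I t, two_sided K t & ldist K t <= eps * rdist K t]].

Definition enlargement (R : realType) (I K : set R) (eps : R) : set R :=
  K `|` right_enlargement I K eps `|` left_enlargement I K eps.

(* For an open set I; functions on I are represented by total functions, and
   as I is open the derivatives at points of I only depend on f restricted
   to I. *)
Definition Cn_on (R : realType) (n : nat) (I : set R) (f : R -> R) : Prop :=
  (forall k, (k < n)%N -> forall t, I t -> derivable (derive1n k f) t 1) /\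
  (forall t, I t -> {for t, continuous (derive1n n f)}).

(* The supremum and infimum are taken in the extended reals, so that the
   inequality with a real C forces the supremum to be finite when S is
   nonempty. *)
Definition polynomial_type (R : realType) (n : nat) (S I : set R) (C : R)
    (f : R -> R) : Prop :=
  [/\ Cn_on n I f,
      (forall t, I t -> 0 <= derive1n n f t) \/ (forall t, I t -> derive1n n f t <= 0)
    & (ereal_sup [set (`|derive1n n f t|)%:E | t in I]
        <= C%:E * ereal_inf [set (`|derive1n n f t|)%:E | t in S])%E].

Definition regular_measure (R : realType)
    (mu : set (measurableTypeR R) -> \bar R) : Prop :=
  forall A : set (measurableTypeR R), measurable A ->
    mu A = ereal_inf [set mu U | U in [set U : set R | open U /\ A `<=` U]] /\
    mu A = ereal_sup [set mu F | F in [set F : set R | compact F /\ F `<=` A]].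

Definition at_most_n_components (T : topologicalType) (n : nat) (E : set T) :
    Prop :=
  connected_component E @` E #<= `I_n.

(* Main.v *)
Require Import Defs.
From HB Require Import structures.
From mathcomp Require Import all_boot all_order all_algebra.
From mathcomp Require Import all_classical all_reals all_analysis.
From mathcomp Require Import measurable_realfun ring lra zify.

Import Order.TTheory GRing.Theory Num.Theory.
Import numFieldNormedType.Exports.

Local Open Scope classical_set_scope.
Local Open Scope ring_scope.

(* Write N_s for the monic polynomial with root set s. For each k <= n choose
   nodes s_k in K such that N_{s_k} nearly minimizes, among monic polynomials of
   degree k with simple roots in K, the level Phi_k below which it stays on a
   set of measure >= 1 - eta_k. If mu is not essentially carried by n atoms then
   Phi_k > 0, and E is the sublevel set
     sum_{k <= n} (N_{s_k} / Phi_k)^2 <= 4 (n + 1)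
   cut to a segment; it has at most n components because the left-hand side is
   a polynomial of degree 2n.
   If |f| <= d on a large set Y, interpolate f at a near-Leja sequence s of Y by
   g: then |g| <= C d on Y, while |f - g| >= kappa |N_s| on Y as soon as f
   coincides on K with a function whose n-th derivative is >= n! kappa. By
   minimality, kappa Phi_n <= C d. The comparison function is f plus bumps
   supported in the gaps of K whose n-th derivative is positive in the middle of
   the gap and negative only near its ends, where f^(n) is large by assumption.
   Hence sup |f^(n)| Phi_n <= C' d, so on E the function f differs by O(d) from
   its interpolation polynomial at s_n, and polynomials of degree < n are
   controlled on E by expanding them along the N_{s_k}. *)

(** * Polynomials whose n-th derivative is bounded below inside (-1, 1) *)

(** Bernoulli's inequality is used twice: it gives [tau <= s ^+ n.+2], and [s ^+ r <= (r x)^-1] with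
    x = 1/s - 1. Hence tau^r <= (r x)^-(n+2), which beats r^n by two powers of r, and any r above A
    / x^(n+2) will do. *)
Lemma polynomial_geometric_decay (R : realType) (n : nat) (A tau : R) :
  0 <= tau -> tau < 1 ->
  exists2 r : nat, (0 < r)%N & A * r%:R ^+ n * tau ^+ r <= 1.
Proof.
move=> tau0 tau1.
pose s := 1 - (1 - tau) / n.+2%:R.
have n2 : (0 : R) < n.+2%:R by rewrite ltr0n.
have d0 : 0 < (1 - tau) / n.+2%:R by rewrite divr_gt0 // subr_gt0.
have s0 : 0 < s.
  rewrite subr_gt0 ltr_pdivrMr // mul1r.
  by apply: (@le_lt_trans _ _ 1); [rewrite lerBlDl lerDr|rewrite ltr1n].
have s1 : s < 1 by rewrite ltrBlDl ltrDr.
have bern (x : R) m : -1 <= x -> 1 + m%:R * x <= (1 + x) ^+ m.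
  move=> x1; elim: m => [|m ih]; first by rewrite mul0r addr0 expr0.
  have x1' : 0 <= 1 + x by rewrite -lerBlDl sub0r.
  have mx : 0 <= m%:R * x ^+ 2 by rewrite mulr_ge0 ?sqr_ge0.
  have := ler_wpM2l x1' ih; rewrite exprS -natr1 => h; apply: le_trans h.
  have e : (1 + x) * (1 + m%:R * x) = 1 + (m%:R + 1) * x + m%:R * x ^+ 2 by ring.
  by rewrite e lerDl.
have ts : tau <= s ^+ n.+2.
  have := bern (- ((1 - tau) / n.+2%:R)) n.+2; rewrite -/s => h.
  apply: le_trans (h _); last first.
    have n21 : (1 : R) <= n.+2%:R by rewrite ler1n.
    by rewrite lerN2 ler_pdivrMr // mul1r; lra.
  by rewrite mulrN mulrC divfK ?gt_eqF // opprB addrC subrK.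
pose x := s^-1 - 1.
have x0 : 0 < x by rewrite subr_gt0 invf_gt1.
have sr r : (0 < r)%N -> s ^+ r <= (r%:R * x)^-1.
  move=> r0; have rx0 : 0 < r%:R * x by rewrite mulr_gt0 ?ltr0n.
  rewrite -[s in s ^+ r]invrK exprVn lef_pV2 ?posrE ?exprn_gt0 ?invr_gt0 //.
  have -> : s^-1 = 1 + x by rewrite /x addrC subrK.
  by apply: le_trans (bern _ _ _); [rewrite lerDr|lra].
have [A0|A0] := leP A 0.
  exists 1%N => //; apply: le_trans ler01.
  by rewrite mulr_le0_ge0 // ?exprn_ge0 // mulr_le0_ge0.
have [r rA] : exists r : nat, A / x ^+ n.+2 <= r%:R.
  by exists (Num.truncn (A / x ^+ n.+2)).+1; apply/ltW/truncnS_gt.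
exists r.+1 => //.
have r0 : (0 : R) < r.+1%:R by rewrite ltr0n.
apply: (@le_trans _ _ (A * r.+1%:R ^+ n * ((r.+1%:R * x) ^+ n.+2)^-1)).
  apply: ler_wpM2l; first by rewrite mulr_ge0 ?exprn_ge0 // ltW.
  apply: (@le_trans _ _ ((s ^+ n.+2) ^+ r.+1)).
    by rewrite lerXn2r // nnegrE exprn_ge0 // ltW.
  rewrite -exprM mulnC exprM -exprVn.
  by rewrite lerXn2r ?nnegrE ?exprn_ge0 ?invr_ge0 ?mulr_ge0 ?sr // ltW.
rewrite ler_pdivrMr ?exprn_gt0 ?mulr_gt0 // mul1r exprMn.
rewrite ler_pdivrMr ?exprn_gt0 // in rA.
have rS : r%:R <= r.+1%:R :> R by rewrite ler_nat.
have xn : 0 < x ^+ n.+2 by rewrite exprn_gt0.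
have : A <= r.+1%:R ^+ 2 * x ^+ n.+2.
  apply: le_trans rA _; rewrite ler_wpM2r ?(ltW xn) //.
  by apply: le_trans rS _; rewrite -natrX ler_nat leq_pmulr.
move=> hA; have -> : r.+1%:R ^+ n.+2 * x ^+ n.+2 = r.+1%:R ^+ n * (r.+1%:R ^+ 2 * x ^+ n.+2).
  by rewrite mulrA -exprD addn2.
by rewrite mulrC ler_wpM2l ?exprn_ge0.
Qed.

(* The witness is 2 X^n (1 - X^(2r))^(n+1) with r large: on [-tau, tau] its n-th
   derivative tends to 2 n! as r grows. *)
Lemma exists_flat_poly (R : realType) (n : nat) (tau : R) : 0 <= tau -> tau < 1 ->
  exists2 q : {poly R}, (1 - 'X^2) ^+ n.+1 %| q &
    forall v : R, `|v| <= tau -> 1 <= q^`(n).[v].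
Proof.
move=> tau0 tau1.
(* For i <= n and r > 0 the exponent n + 2r(i+1) is at most D r, so each falling factorial below is
   at most (D r)^n. The factor 2^(n+2) pays for the sum of the binomials, at most 2^(n+1), and for a
   tail of at most 1/2. *)
pose D := (n + 2 * n.+1)%N.
have [r r0 hr] := polynomial_geometric_decay _ n (2 ^+ n.+2 * D%:R ^+ n) tau tau0 tau1.
pose q : {poly R} := 'X^n * (1 - 'X^(2 * r)) ^+ n.+1.
have dq : (1 - 'X^2) ^+ n.+1 %| q.
  apply: dvdp_mull; apply: dvdp_exp2r.
  have opp m : (1 : {poly R}) - 'X^m = - ('X^m - 1) by rewrite opprB.
  rewrite opp (opp (2 * r)%N) dvdpNl dvdpNr exprM [X in _ %| X]subrX1.
  exact: dvdp_mulr.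
exists (q *+ 2); first by rewrite mulr2n dvdp_add.
move=> v hv; rewrite derivnMn hornerMn.
(* Binomial expansion of the n-th derivative: [T 0] is n! and the other terms add up to at most 1/2,
   so doubling the polynomial gives at least 2 n! - 1 >= 1. *)
pose T (i : nat) : R := (-1) ^+ i * v ^+ (2 * r * i) * (('C(n.+1, i))%:R * ((n + 2 * r * i) ^_ n)%:R).
have -> : q^`(n).[v] = \sum_(i < n.+2) T i.
  rewrite /q exprBn mulr_sumr raddf_sum /= horner_sum; apply: eq_bigr => i _.
  have -> : 'X^n * ((-1) ^+ i * 1 ^+ (n.+1 - i) * ('X^(2 * r)) ^+ i *+ 'C(n.+1, i))
      = (((-1) ^+ i)%:P * 'X^(n + 2 * r * i)) *+ 'C(n.+1, i) :> {poly R}.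
    rewrite expr1n mulr1 -exprM mulrnAr exprD rmorphXn /= rmorphN1.
    by rewrite mulrCA.
  rewrite derivnMn mul_polyC derivnZ derivnXn addKn hornerMn hornerZ hornerMn hornerXn.
  rewrite /T -[_ *+ 'C(_,_)]mulr_natr -[_ *+ (_ ^_ _)]mulr_natr; ring.
rewrite big_ord_recl /T /= expr0 muln0 expr0 addn0 bin0 !mul1r ffactnn.
have ffactX m k : (m ^_ k <= m ^ k)%N.
  rewrite ffact_prod -[in leqRHS](card_ord k) -prod_nat_const.
  by apply: leq_prod => i _; exact: leq_subr.
have expn_le a1 a2 k : (a1 <= a2 -> a1 ^ k <= a2 ^ k)%N.
  by case: k => // k; rewrite leq_exp2r.
have b : `|\sum_(i < n.+1) T i.+1| <= 2^-1.
  apply: le_trans (ler_norm_sum _ _ _) _.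
  apply: (@le_trans _ _ (\sum_(i < n.+1) ('C(n.+1, i.+1))%:R * (D%:R ^+ n * r%:R ^+ n * tau ^+ r))).
    apply: ler_sum => i _; rewrite /T !normrM !normrX normrN1 expr1n mul1r !normr_nat mulrCA.
    rewrite ler_wpM2l // mulrC ler_pM ?exprn_ge0 //.
      rewrite -exprMn -natrM -natrX ler_nat.
      apply: (@leq_trans ((n + 2 * r * i.+1) ^ n)); first exact: ffactX.
      apply: expn_le.
      by have := ltn_ord i; rewrite /D; clear -r0; nia.
    apply: (@le_trans _ _ (tau ^+ (2 * r * i.+1))); first by rewrite lerXn2r // nnegrE.
    rewrite ler_wiXn2l //; first exact: ltW.
    by clear; nia.
  rewrite -mulr_suml.
  have c2 : \sum_(i < n.+1) ('C(n.+1, i.+1))%:R <= 2 ^+ n.+1 :> R.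
    have -> : 2 ^+ n.+1 = \sum_(i < n.+2) ('C(n.+1, i))%:R :> R.
      rewrite [2](_ : _ = 1 + 1) // exprDn; apply: eq_bigr => i _.
      by rewrite !expr1n mulr1.
    by rewrite [leRHS]big_ord_recl lerDr.
  have w0 : 0 <= D%:R ^+ n * r%:R ^+ n * tau ^+ r by rewrite !mulr_ge0 ?exprn_ge0.
  apply: le_trans (ler_wpM2r w0 c2) _.
  move: hr; rewrite exprS -!mulrA => hr.
  by rewrite -(ler_pM2l (ltr0n R 2)) divff ?pnatr_eq0.
have f1 : (1 : R) <= n`!%:R by rewrite ler1n fact_gt0.
rewrite mulr2n; move: b; rewrite ler_norml => /andP[b1 b2].
by rewrite /T in b1 b2 *; lra.
Qed.

(** * Iterated Rolle theorem and the interpolation error *)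

(** A function is carried along with explicit candidates for its derivatives, so that bumps and
    polynomials can be added or subtracted order by order; continuity of [D n] is not part of it. *)
Definition jet {R : realType} (n : nat) (I : set R) (D : nat -> R -> R) : Prop :=
  forall k, (k < n)%N -> forall t, I t -> is_derive t 1 (D k) (D k.+1 t).

(** Rolle between consecutive zeros: the [(size s).+1] zeros [x :: s] yield [size s] zeros of the
    derivative. Having [s'] increase from [x] lets the induction put the zero found in ]x, y[ in
    front of the path that starts from [y]. *)
Lemma rolle_path {R : realType} (J : set R) (f g : R -> R) (x : R) (s : seq R) :
  is_interval J -> (forall t, J t -> is_derive t 1 f (g t)) ->
  path <%R x s -> J x -> {in s, forall y, J y} -> f x = 0 -> {in s, forall y, f y = 0} ->
  exists s' : seq R, [/\ size s' = size s, path <%R x s', {in s', forall y, J y}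
    & {in s', forall y, g y = 0}].
Proof.
move=> Jitv fg; elim: s x => [|y s ih] x; first by exists [::].
move=> /= /andP[xy ys] Jx Js fx fs.
have Jy : J y by apply: Js; rewrite mem_head.
have fy : f y = 0 by apply: fs; rewrite mem_head.
have [||s' [ss' ps' Js' gs']] := ih y ys Jy _ fy.
- by move=> z zs; apply: Js; rewrite in_cons zs orbT.
- by move=> z zs; apply: fs; rewrite in_cons zs orbT.
have Jxy z : x <= z <= y -> J z by apply: Jitv.
have Joo z : z \in `]x, y[ -> J z.
  by rewrite in_itv /= => /andP[xz zy]; apply: Jxy; rewrite !ltW.
have [|||c cxy [_ cg]] := @Rolle R f x y xy; last 1 first.
- exists (c :: s'); split.
  + by rewrite /= ss'.
  + move: cxy; rewrite in_itv /= => /andP[-> cy] /=.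
    by case: s' ps' {ss' Js' gs'} => //= z s' /andP[yz ->]; rewrite (lt_trans cy yz).
  + move=> z; rewrite in_cons => /orP[/eqP ->|/Js'//].
    exact: Joo.
  + move=> z; rewrite in_cons => /orP[/eqP ->|/gs'//].
    by rewrite -cg; have [_ <-] := fg c (Joo _ cxy).
- by move=> z /Joo Jz; have [] := fg z Jz.
- apply: derivable_within_continuous => z; rewrite in_itv /= => xzy.
  by have [] := fg z (Jxy _ xzy).
- by rewrite fx fy.
Qed.

Lemma rolle_jet {R : realType} (n : nat) (J : set R) (D : nat -> R -> R) (s : seq R) :
  is_interval J -> jet n J D -> uniq s -> size s = n.+1 ->
  {in s, forall y, J y} -> {in s, forall y, D 0%N y = 0} ->
  exists2 xi, J xi & D n xi = 0.
Proof.
move=> Jitv jD us ss Js Ds.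
have [x [s' [ps' ss' Jx Js' [Dx Ds']]]] : exists x s', [/\ path <%R x s', size s' = n,
    J x, {in s', forall y, J y} & D 0%N x = 0 /\ {in s', forall y, D 0%N y = 0}].
  have : sorted <%R (sort <=%R s) by rewrite sort_lt_sorted.
  have : size (sort <=%R s) = n.+1 by rewrite size_sort.
  have Js' : {in sort <=%R s, forall y, J y} by move=> y; rewrite mem_sort => /Js.
  have Ds' : {in sort <=%R s, forall y, D 0%N y = 0} by move=> y; rewrite mem_sort => /Ds.
  case: (sort <=%R s) Js' Ds' => // x s' Js' Ds' [ss'] ps'.
  exists x, s'; split => //.
  - by apply: Js'; rewrite mem_head.
  - by move=> y ys; apply: Js'; rewrite in_cons ys orbT.
  - split; first by apply: Ds'; rewrite mem_head.
    by move=> y ys; apply: Ds'; rewrite in_cons ys orbT.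
elim: n D x s' {us ss Js Ds s} jD ps' ss' Jx Js' Dx Ds' => [|n ih] D x s jD ps ss Jx Js Dx Ds.
  by exists x.
have [s' [ss' ps' Js' Ds']] :=
  rolle_path _ _ _ _ _ Jitv (jD 0%N isT) ps Jx Js Dx Ds.
case: s' ss' ps' Js' Ds'; first by rewrite ss.
move=> y s' /= ss' /andP[_ ps'] Js' Ds'.
have [|||||||xi Jxi Dxi] := ih (fun k => D k.+1) y s'; last by exists xi.
- by move=> k kn t Jt; apply: jD.
- by [].
- by move: ss'; rewrite ss => -[].
- by apply: Js'; rewrite mem_head.
- by move=> z zs; apply: Js'; rewrite in_cons zs orbT.
- by apply: Ds'; rewrite mem_head.
- by move=> z zs; apply: Ds'; rewrite in_cons zs orbT.
Qed.

Definition nodal {R : realType} (s : seq R) : {poly R} := \prod_(x <- s) ('X - x%:P).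

Lemma size_nodal {R : realType} (s : seq R) : size (nodal s) = (size s).+1.
Proof. exact: size_prod_XsubC. Qed.

Lemma root_nodal {R : realType} (s : seq R) (x : R) : root (nodal s) x = (x \in s).
Proof. exact: root_prod_XsubC. Qed.

Lemma derivn_nodal {R : realType} (s : seq R) :
  (nodal s)^`(size s) = ((size s)`!%:R)%:P.
Proof.
apply/polyP => -[|i]; rewrite coef_derivn coefC /= ?addn0.
  have -> : (nodal s)`_(size s) = lead_coef (nodal s) by rewrite lead_coefE size_nodal.
  by rewrite (monicP (monic_prod_XsubC _ _ _)) ffactnn.
by rewrite nth_default ?mul0rn // size_nodal addnS ltnS leq_addr.
Qed.

(** The coefficient [lam] makes [D 0 - p - lam N_s] vanish at [t] as well as on [s]. With n + 1
    zeros, its n-th derivative [D n - lam n!] vanishes somewhere in [J], since [p] has degree below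
    n. *)
Lemma interpolation_error {R : realType} (n : nat) (J : set R) (D : nat -> R -> R)
    (s : seq R) (p : {poly R}) (t : R) :
  is_interval J -> jet n J D -> uniq s -> size s = n -> {in s, forall x, J x} ->
  (size p <= n)%N -> {in s, forall x, p.[x] = D 0%N x} -> J t ->
  exists2 xi, J xi & D 0%N t - p.[t] = D n xi / n`!%:R * (nodal s).[t].
Proof.
move=> Jitv jD us ss Js sp ps Jt.
have [ts|ts] := boolP (t \in s).
  exists t => //; have /rootP -> : root (nodal s) t by rewrite root_nodal.
  by rewrite mulr0 ps // subrr.
have N0 : (nodal s).[t] != 0 by rewrite -[_ == 0]/(root _ _) root_nodal.
pose lam := (D 0%N t - p.[t]) / (nodal s).[t].
pose q := p + lam *: nodal s.
have [||||||xi Jxi] := rolle_jet n J (fun k => D k \- horner (q^`(k))) (t :: s).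
- exact: Jitv.
- move=> k kn x Jx; apply: is_deriveB; exact: jD.
- by rewrite /= ts.
- by rewrite /= ss.
- by move=> x; rewrite in_cons => /orP[/eqP ->|/Js].
- move=> x; rewrite in_cons => /orP[/eqP ->|xs] /=.
    by rewrite ?derivn0 /q hornerD hornerZ /lam divfK //; ring.
  have /rootP N1 : root (nodal s) x by rewrite root_nodal.
  by rewrite ?derivn0 /q hornerD hornerZ N1 mulr0 addr0 ps // subrr.
move=> /= /eqP; rewrite subr_eq0 => /eqP Dxi; exists xi => //.
rewrite Dxi /q derivnD derivnZ -{2}ss derivn_nodal derivn_poly0 // add0r.
rewrite hornerZ hornerC ss mulfK ?pnatr_eq0 -?lt0n ?fact_gt0 //.
by rewrite /lam divfK.
Qed.

(** * Bump functions obtained by truncating polynomials *)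

Definition truncated {R : realType} (q : {poly R}) (v : R) : R :=
  if `|v| <= 1 then q.[v] else 0.

(** Writing q = (1 - X^2)^2 s, the truncation is psi(1 - v^2) s(v), where psi(u) is u^2 for u >= 0
    and 0 otherwise. Only the differentiability of psi at 0 needs a separate argument, and the
    points 1 and -1 are then covered by the chain rule. *)
Lemma is_derive_truncated {R : realType} (q : {poly R}) (v : R) :
  (1 - 'X^2) ^+ 2 %| q -> is_derive v 1 (truncated q) (truncated q^`() v).
Proof.
case/dvdpP => s qs.
pose psi (u : R) := if 0 <= u then u ^+ 2 else 0.
pose dpsi (u : R) := if 0 <= u then 2 * u else 0.
have psid (u : R) : is_derive u (1 : R) psi (dpsi u).
  have [u0|u0|->] := ltrgtP u 0.
  - rewrite /dpsi leNgt u0 /=.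
    apply: (near_eq_is_derive (f := cst (0 : R))).
    near=> z; rewrite /psi leNgt (_ : z < 0) //; near: z; exact: lt_nbhsl.
  - rewrite /dpsi ltW //.
    apply: (near_eq_is_derive (f := (id ^+ 2 : R -> R))); last first.
      by apply: is_derive_eq; rewrite /GRing.scale /= expr1; ring.
    near=> z; rewrite /psi (_ : 0 <= z) //; apply: ltW; near: z; exact: lt_nbhsr.
  - rewrite /dpsi lexx mulr0.
    have h : (h^-1 *: ((psi \o shift 0) (h *: 1) - psi 0)) @[h --> (0 : R)^'] --> (0 : R).
      apply/cvgr0Pnorm_lt => e e0; near=> h.
      have h0 : h != 0 by near: h; exact: nbhs_dnbhs_neq.
      have he : `|h| < e.
        near: h; apply: dnbhs0_lt; exact: e0.
      rewrite /psi /= lexx expr0n /= subr0 addr0 /GRing.scale /= mulr1.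
      case: ifP => _; last by rewrite mulr0 normr0.
      by rewrite expr2 mulrA mulVf // mul1r.
    by apply: DeriveDef; [apply/cvg_ex; exists 0|exact: cvg_lim].
have norm_le1 (w : R) : (`|w| <= 1) = (0 <= 1 - w ^+ 2).
  rewrite subr_ge0 -[w ^+ 2]real_normK ?num_real //.
  by rewrite -[X in _ = (_ <= X)](expr1n _ 2) ler_sqr ?nnegrE.
have hX (w : R) : (1 - 'X^2 : {poly R}).[w] = 1 - w ^+ 2 by rewrite !hornerE.
have -> : truncated q = (psi \o horner (1 - 'X^2)) * horner s.
  apply/funext => w; rewrite /truncated qs norm_le1 -[RHS]/(psi _ * _) hX /psi.
  rewrite hornerM horner_exp hX.
  by case: ifP => _; rewrite ?mul0r // mulrC.
have dX : is_derive v (1 : R) (psi \o horner (1 - 'X^2)) (dpsi (1 - v ^+ 2) * (1 - 'X^2 : {poly R})^`().[v]).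
  by apply: is_derive1_comp; rewrite -hX; exact: psid.
apply: (is_derive_eq (is_deriveM dX (is_derive_poly s v))).
rewrite /truncated norm_le1 qs derivM hornerD !hornerM /GRing.scale /= hX /psi /dpsi.
have -> : ((1 - 'X^2 : {poly R}) ^+ 2)^`() = (1 - 'X^2) * (1 - 'X^2)^`() *+ 2.
  by rewrite expr2 derivM [in RHS]mulr2n mulrC.
rewrite hornerMn !hornerM ?horner_exp ?hX.
case: ifP => _; last by rewrite !mul0r !mulr0 addr0.
ring.
Unshelve. all: by end_near. Qed.

Lemma dvdp_exp_deriv {R : realType} (d q : {poly R}) (m : nat) :
  d ^+ m.+1 %| q -> d ^+ m %| q^`().
Proof.
case/dvdpP => s ->; rewrite derivM deriv_exp /=.
rewrite dvdp_add //; first by rewrite dvdp_mull // exprS dvdp_mull.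
by rewrite -mulr_natr dvdp_mull // dvdp_mulr // dvdp_mull.
Qed.

Lemma dvdp_exp_derivn {R : realType} (d q : {poly R}) (m k : nat) :
  d ^+ (m + k) %| q -> d ^+ m %| q^`(k).
Proof.
elim: k q => [|k ih] q; first by rewrite addn0 derivn0.
by rewrite addnS derivSn => /dvdp_exp_deriv /ih.
Qed.

Lemma horner_bounded_unit {R : realType} (q : {poly R}) :
  exists2 B : R, 0 <= B & forall v : R, `|v| <= 1 -> `|q.[v]| <= B.
Proof.
exists (\sum_(i < size q) `|q`_i|); first exact: sumr_ge0.
move=> v v1; rewrite horner_coef; apply: le_trans (ler_norm_sum _ _ _) _.
apply: ler_sum => i _; rewrite normrM normrX ler_piMr //.
by rewrite exprn_ile1.
Qed.

(** The truncated flat polynomial is transported to [a, b] and scaled by l^n, with l the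
    half-length, so that its n-th derivative is that of the model at the rescaled point. This is why
    [B] does not depend on a and b. *)
Lemma exists_bump {R : realType} (n : nat) (tau : R) : 0 <= tau -> tau < 1 ->
  exists2 B : R, 0 <= B & forall a b : R, a < b -> exists H : nat -> R -> R,
    [/\ jet n setT H,
        forall t, ~ a < t < b -> H 0%N t = 0 /\ H n t = 0,
        forall t, `|t - (a + b) / 2| <= tau * ((b - a) / 2) -> 1 <= H n t
      & forall t, `|H n t| <= B].
Proof.
move=> tau0 tau1; have [q dq q1] := exists_flat_poly R n tau tau0 tau1.
have [B B0 qB] := horner_bounded_unit q^`(n).
exists B => // a b ab.
pose l := (b - a) / 2; pose c := (a + b) / 2.
have l0 : 0 < l by rewrite divr_gt0 // subr_gt0.
pose u (t : R) := (t - c) / l.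
(* The endpoints are included: 1 - X^2 still divides the k-th derivative for k <= n, because its
   exponent in [q] is n + 1. *)
have out k t : (k <= n)%N -> ~ a < t < b -> truncated q^`(k) (u t) = 0.
  move=> kn tab; rewrite /truncated; case: ifPn => // u1.
  have u2 : u t ^+ 2 = 1.
    rewrite -real_normK ?num_real // (_ : `|u t| = 1) ?expr1n //.
    apply/eqP; rewrite eq_le u1 /= leNgt; apply/negP => ult1; apply: tab.
    move: ult1; rewrite /u normrM [X in _ * X]gtr0_norm ?invr_gt0 // ltr_pdivrMr // mul1r.
    by rewrite ltr_norml /c /l => /andP[h1 h2]; apply/andP; split; lra.
  have /dvdpP[s ->] : (1 - 'X^2) ^+ 1 %| q^`(k).
    apply: dvdp_exp_derivn; apply: dvdp_trans dq; apply: dvdp_exp2l.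
    by rewrite add1n.
  by rewrite expr1 hornerM !hornerE u2 subrr mulr0.
exists (fun k t => l ^+ n * l ^- k * truncated q^`(k) (u t)); split.
- move=> k kn t _.
  have du : is_derive t (1 : R) u l^-1.
    have -> : u = (l^-1 \*: (id - cst c : R -> R)).
      by apply/funext => x; rewrite /u /= /GRing.scale /= mulrC.
    by apply: is_derive_eq; rewrite subr0 /GRing.scale /= mulr1.
  have dT : is_derive (u t) (1 : R) (truncated q^`(k)) (truncated q^`(k.+1) (u t)).
    rewrite derivnS; apply: is_derive_truncated; apply: dvdp_exp_derivn.
    by apply: dvdp_trans dq; apply: dvdp_exp2l; rewrite add2n !ltnS.
  have := is_deriveZ (l ^+ n * l ^- k) (is_derive1_comp dT du).
  move=> h; apply: (is_derive_eq h); rewrite /GRing.scale /=.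
  by rewrite exprS (invfM l); ring.
- by move=> t tab; rewrite !out // !mulr0.
- move=> t; rewrite mulfV ?mul1r ?expf_neq0 ?gt_eqF // -/l -/c => ht.
  have ut : `|u t| <= tau.
    by rewrite /u normrM [X in _ * X]gtr0_norm ?invr_gt0 // ler_pdivrMr.
  by rewrite /truncated (le_trans ut (ltW tau1)) q1.
- move=> t; rewrite mulfV ?mul1r ?expf_neq0 ?gt_eqF // /truncated.
  by case: ifPn => [/qB//|_]; rewrite normr0.
Qed.

(** * The comparison function that fills the gaps of K *)

(** Compactness of [a, b]. Around z either [g] stays above [m'] by continuity, or [g z <= m' < m]
    forces z outside the closed set [K], and then no point of [K] is near. *)
Lemma uniform_near_closed {R : realType} (K : set R) (g : R -> R) (a b m m' : R) :
  closed K -> {in `[a, b], continuous g} -> m' < m ->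
  (forall x, K x -> a <= x <= b -> m <= g x) ->
  exists2 rho : R, 0 < rho & forall x t, K x -> a <= x <= b -> a <= t <= b ->
    `|x - t| < rho -> m' <= g t.
Proof.
move=> clK cg mm' Kg.
pose P (rho t : R) := forall x, K x -> a <= x <= b -> `|x - t| < rho -> m' <= g t.
suff loc z : `[a, b]%classic z ->
    exists2 r : R, 0 < r & forall t rho, `|z - t| < r -> rho < r -> P rho t.
  have /compact_near_coveringP cov := @segment_compact R a b.
  have /= : \forall rho \near (0 : R)^'+, `[a, b]%classic `<=` P rho.
    apply: cov => z /loc[r r0 Pr].
    exists ([set t | `|z - t| < r], [set rho | rho < r]).
      by split; [exact: nbhsx_ballx|exact: nbhs_right_lt].
    by move=> [t rho] /= [h1 h2]; exact: (Pr t rho h1 h2).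
  move=> near0; have [rho [rho0 Prho]] : exists rho, 0 < rho /\ (`[a, b]%classic `<=` P rho).
    near (0 : R)^'+ => rho; exists rho; split; near: rho; [exact: nbhs_right_gt|exact: near0].
  exists rho => // x t Kx xab tab; apply: (Prho t) => //.
move=> zab; have [gz|gz] := ltP m' (g z).
  have gzP := cvgr_gt (g z) (cg z zab) _ gz.
  have /nbhs_ballP[r /= r0 rP] : nbhs z (fun t => m' < g t) by exact: gzP.
  exists r => // t rho zt _ x _ _ _.
  by apply/ltW/rP.
have nKz : (~` K) z.
  move=> Kz; have := Kg z Kz; rewrite -[_ && _]/(z \in `[a, b]) => /(_ zab) h.
  by have := lt_le_trans mm' h; rewrite ltNge gz.
have : nbhs z (~` K) by apply: open_nbhs_nbhs; split => //; exact: closed_openC.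
move=> /nbhs_ballP[r /= r0 rP]; exists (r / 2); first by rewrite divr_gt0.
move=> t rho zt rhor x Kx _ xt; exfalso; apply: (rP x) => //.
rewrite /ball /=.
have -> : z - x = (z - t) - (x - t) by ring.
by apply: le_lt_trans (ler_normB _ _) _; lra.
Unshelve. all: by end_near. Qed.

Lemma closed_inf {R : realType} (A : set R) : closed A -> has_inf A -> A (inf A).
Proof.
move=> clA hA; apply: contrapT => nA.
have : nbhs (inf A) (~` A) by apply: open_nbhs_nbhs; split => //; exact: closed_openC.
move=> /nbhs_ballP[r /= r0 rP]; have [x Ax xr] := inf_adherent r0 hA.
apply: (rP x) => //; rewrite /ball /= distrC ger0_norm; first by rewrite ltrBlDl.
by rewrite subr_ge0; apply: ge_inf => //; have [] := hA.
Qed.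

Lemma closed_sup {R : realType} (A : set R) : closed A -> has_sup A -> A (sup A).
Proof.
move=> clA hA; apply: contrapT => nA.
have : nbhs (sup A) (~` A) by apply: open_nbhs_nbhs; split => //; exact: closed_openC.
move=> /nbhs_ballP[r /= r0 rP]; have [x Ax xr] := sup_adherent r0 hA.
apply: (rP x) => //; rewrite /ball /= ger0_norm; first by rewrite ltrBlDl -ltrBlDr.
by rewrite subr_ge0; apply: ub_le_sup => //; have [] := hA.
Qed.

(** Where [f n] is at least m / 2, the scaled bumps are too small to destroy positivity. Any other
    point of [a, b] lies in a gap and outside the enlargement, hence in the middle part of the gap,
    where the bump alone contributes [c * m]. The bound on the bumps is independent of the gaps, so
    [c] depends on n and eps only. *)
Lemma fill_gaps {R : realType} (n : nat) (eps : R) : 0 < eps -> eps < 1 ->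
  exists2 c : R, 0 < c & forall (I K : set R) (f : nat -> R -> R) (a b m : R),
    closed K -> K a -> K b -> `[a, b]%classic `<=` I -> jet n I f ->
    {in `[a, b], continuous (f n)} ->
    (forall t, a <= t <= b -> 0 <= f n t) -> 0 < m ->
    (forall t, a <= t <= b -> enlargement I K eps t -> m <= f n t) ->
    exists D : nat -> R -> R, [/\ jet n I D, forall t, K t -> D 0%N t = f 0%N t
      & forall t, a <= t <= b -> c * m <= D n t].
Proof.
move=> e0 e1.
(* In a gap with centre z and half-length l, the two conditions for being outside the enlargement
   amount to |t - z| < tau l. *)
pose tau := (1 - eps) / (1 + eps).
have e1p : 0 < 1 + eps by rewrite addr_gt0.
have tau0 : 0 <= tau by rewrite divr_ge0 ?ltW // subr_gt0.
have tau1 : tau < 1 by rewrite ltr_pdivrMr // mul1r; lra.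
have [B B0 bump] := exists_bump n tau tau0 tau1.
(* Here c B = 1/4 - c, so a bump scaled by c m lowers the n-th derivative by at most m/4 - c m. *)
pose c := (4 * (B + 1))^-1.
have c0 : 0 < c by rewrite invr_gt0 mulr_gt0 // ltr_wpDl.
exists c => // I K f a b m clK Ka Kb abI jf cf f0 m0 fm.
have KE t : K t -> enlargement I K eps t by move=> Kt; left; left.
have [rho rho0 rhoP] : exists2 rho : R, 0 < rho & forall x t, K x -> a <= x <= b ->
    a <= t <= b -> `|x - t| < rho -> m / 2 <= f n t.
  apply: (@uniform_near_closed _ K (f n) a b m) => //; first lra.
  by move=> x Kx xab; apply: fm => //; exact: KE.
pose Hspec (g : R * R) (H : nat -> R -> R) := g.1 < g.2 ->
    [/\ jet n setT H,
        forall t, ~ g.1 < t < g.2 -> H 0%N t = 0 /\ H n t = 0,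
        forall t, `|t - (g.1 + g.2) / 2| <= tau * ((g.2 - g.1) / 2) -> 1 <= H n t
      & forall t, `|H n t| <= B].
have /choice[H HP] : forall g, exists H, Hspec g H.
  move=> g; rewrite /Hspec.
  have [gg|gg] := ltP g.1 g.2; last by exists (fun _ _ => 0).
  by have [H HH] := bump _ _ gg; exists H.
pose gap (g : R * R) := [/\ g.1 < g.2, K g.1, K g.2, a <= g.1 & g.2 <= b] /\
    forall x, K x -> ~ g.1 < x < g.2.
(* A point where f^(n) < m / 2 is at distance >= rho from K, so only the finitely
   many gaps meeting a grid of mesh rho need a bump. *)
have [G [uG Ggap GP]] : exists G : seq (R * R), [/\ uniq G, {in G, forall g, gap g} &
    forall t, a <= t <= b -> f n t < m / 2 -> exists2 g, g \in G & g.1 < t < g.2].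
  pose lo x := sup [set y | K y /\ y <= x]; pose hi x := inf [set y | K y /\ x <= y].
  have lohi x : a <= x <= b -> ~ K x -> gap (lo x, hi x) /\ lo x < x < hi x.
    move=> /andP[ax xb] nKx.
    have sl : has_sup [set y | K y /\ y <= x].
      by split; [exists a|exists x => y [_]].
    have sh : has_inf [set y | K y /\ x <= y].
      by split; [exists b|exists x => y [_]].
    have cl1 : closed [set y | K y /\ y <= x] by apply: closedI => //; exact: closed_le.
    have cl2 : closed [set y | K y /\ x <= y] by apply: closedI => //; exact: closed_ge.
    have [Kl lx] : K (lo x) /\ lo x <= x by exact: (closed_sup _ cl1 sl).
    have [Kh xh] : K (hi x) /\ x <= hi x by exact: (closed_inf _ cl2 sh).
    have lx' : lo x < x by rewrite lt_neqAle lx andbT; apply/eqP => h; apply: nKx; rewrite -h.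
    have xh' : x < hi x by rewrite lt_neqAle xh andbT; apply/eqP => h; apply: nKx; rewrite h.
    split; last by rewrite lx'.
    split; first split => //=.
    - exact: lt_trans lx' xh'.
    - by apply: ub_le_sup => //; case: sl.
    - by apply: ge_inf => //; case: sh.
    - move=> y Ky /= /andP[ly yh]; have [yx|xy] := leP y x.
        by move: ly; rewrite ltNge => /negP; apply; apply: ub_le_sup => //; case: sl.
      move: yh; rewrite ltNge => /negP; apply; apply: ge_inf; first by case: sh.
      by split => //; exact: ltW.
  pose N := (Num.truncn ((b - a) / rho)).+1.
  pose xs := [seq x <- [seq a + i%:R * rho | i <- iota 0 N] | (a <= x <= b) && `[< ~ K x >]].
  exists (undup [seq (lo x, hi x) | x <- xs]); split; first exact: undup_uniq.
    move=> g; rewrite mem_undup => /mapP[x]; rewrite mem_filter => /andP[/andP[xab /asboolP nKx] _] ->.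
    by have [] := lohi x xab nKx.
  move=> t /[dup] tab /andP[at_ tb] ft.
  have far x : K x -> a <= x <= b -> rho <= `|x - t|.
    by move=> Kx xab; rewrite leNgt; apply/negP => /(rhoP x t Kx xab tab); rewrite leNgt ft.
  (* [x] is the last grid point not beyond [t]. It is closer than rho to [t], so it is outside [K],
     and its gap reaches beyond [t] because the right end of the gap is at distance at least rho
     from [t]. *)
  pose i := Num.truncn ((t - a) / rho); pose x := a + i%:R * rho.
  have ta0 : 0 <= (t - a) / rho by rewrite divr_ge0 ?subr_ge0 // ltW.
  have xt : x <= t by rewrite /x -lerBrDl -ler_pdivlMr // truncn_le.
  have tx : t < x + rho.
    rewrite /x -addrA -[X in _ + (_ + X)]mul1r -mulrDl natr1 -ltrBlDl -ltr_pdivrMr //.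
    exact: truncnS_gt.
  have ax : a <= x by rewrite lerDl mulr_ge0 // ltW.
  have xab : a <= x <= b by rewrite ax (le_trans xt).
  have nKx : ~ K x.
    move=> Kx; have := far x Kx xab; rewrite distrC ger0_norm ?subr_ge0 // leNgt.
    by rewrite ltrBlDl tx.
  have [[[_ Kl Kh al hb] gK] /andP[lx xh]] := lohi x xab nKx.
  exists (lo x, hi x) => /=.
    rewrite mem_undup; apply/mapP; exists x => //; rewrite mem_filter xab andTb.
    apply/andP; split; first exact/asboolP.
    apply/mapP; exists i => //; rewrite mem_iota leq0n add0n -(ltr_nat R).
    apply: le_lt_trans (truncnS_gt _); apply: (@le_trans _ _ ((t - a) / rho)).
      by rewrite truncn_le.
    by rewrite ler_wpM2r ?invr_ge0 ?(ltW rho0) // lerD2r.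
  rewrite (lt_le_trans lx xt) /= ltNge; apply/negP => ht.
  have := far _ Kh; rewrite /= hb andbT => /(_ (le_trans ax (ltW xh))).
  rewrite distrC ger0_norm ?subr_ge0 // leNgt => /negP; apply.
  by rewrite /= in xh ht *; lra.
pose D k t := f k t + c * m * \sum_(g <- G) H g k t.
exists D; split.
- move=> k kn t It.
  pose S j x := \sum_(g <- G) H g j x.
  have dS : is_derive t (1 : R) (S k) (S k.+1 t).
    rewrite /S; clear S D; elim: G Ggap {uG GP} => [_|g G ih GG].
      have -> : (fun x => \sum_(g <- [::]) H g k x) = cst 0 by apply/funext => x; rewrite big_nil.
      by rewrite big_nil; exact: is_derive_cst.
    have -> : (fun x => \sum_(h <- g :: G) H h k x) = (H g k + (fun x => \sum_(h <- G) H h k x)).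
      by apply/funext => x; rewrite big_cons.
    rewrite big_cons; apply: is_deriveD.
      have [[gg _ _ _ _] _] := GG g (mem_head _ _); have [jH _ _ _] := HP _ gg.
      exact: jH.
    by apply: ih => h hG; apply: GG; rewrite in_cons hG orbT.
  apply: (is_derive_eq (is_deriveD (jf k kn t It) (is_deriveZ (c * m) dS))) => //.
- move=> t Kt; rewrite /D big_seq big1 ?mulr0 ?addr0 // => g gG.
  have [[gg _ _ _ _] gK] := Ggap g gG; have [_ H0 _ _] := HP g gg.
  by have [] := H0 t (gK t Kt).
- move=> t tab; rewrite /D.
  have cm0 : 0 < c * m by rewrite mulr_gt0.
  (* Gaps sharing a point coincide, so at most one bump is nonzero at [t] and the sum is bounded by
     [B] whatever the number of gaps. *)
  have dis g g' : gap g -> gap g' -> g.1 < t < g.2 -> g'.1 < t < g'.2 -> g = g'.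
    move=> [[_ Kg1 Kg2 _ _] gK] [[_ Kg1' Kg2' _ _] gK'] /andP[t1 t2] /andP[t1' t2'].
    rewrite [g]surjective_pairing [g']surjective_pairing; congr pair.
      apply/eqP; rewrite eq_le !leNgt; apply/andP; split; apply/negP => h.
        by apply: (gK' _ Kg1); rewrite h /= (lt_trans t1).
      by apply: (gK _ Kg1'); rewrite h /= (lt_trans t1').
    apply/eqP; rewrite eq_le !leNgt; apply/andP; split; apply/negP => h.
      by apply: (gK _ Kg2'); rewrite h andbT (lt_trans t1).
    by apply: (gK' _ Kg2); rewrite h andbT (lt_trans t1').
  have Sone g : g \in G -> g.1 < t < g.2 -> \sum_(g <- G) H g n t = H g n t.
    move=> gG tg; rewrite (bigD1_seq g) //= big_seq_cond big1 ?addr0 // => g' /andP[gG' gg'].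
    have [[gg'' _ _ _ _] _] := Ggap _ gG'; have [_ H0 _ _] := HP _ gg''.
    have [|_ //] := H0 t; move=> tg'; move/eqP: gg'; apply.
    by apply: dis => //; exact: Ggap.
  have Sbd : `|\sum_(g <- G) H g n t| <= B.
    have [/hasP[g gG tg]|/hasPn nG] := boolP (has (fun g => g.1 < t < g.2) G).
      by rewrite (Sone g) //; have [[gg _ _ _ _] _] := Ggap _ gG; have [_ _ _ HB] := HP _ gg; exact: HB.
    rewrite big_seq big1 ?normr0 // => g gG.
    have [[gg _ _ _ _] _] := Ggap _ gG; have [_ H0 _ _] := HP _ gg.
    by have [|_ //] := H0 t; exact/negP/nG.
  have [fmt|fmt] := leP (m / 2) (f n t).
    have cB : c * (4 * (B + 1)) = 1 by rewrite mulVf // gt_eqF // mulr_gt0 // ltr_wpDl.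
    move: Sbd; rewrite ler_norml => /andP[+ _] => Sl.
    have := ler_wpM2l (ltW cm0) Sl.
    have cB' : c * B = 4^-1 - c by lra.
    have -> : c * m * - B = - (m * (c * B)) by ring.
    rewrite cB' => h; move: fmt cm0 m0 h.
    have -> : m * (4^-1 - c) = m / 4 - c * m by ring.
    by set y := _ * \sum_(_ <- _) _; clear; lra.
  (* Remaining case: [f n t < m / 2]. Since [f n t >= 0], it is enough that the bump of this gap is
     at least 1 at [t]; the one-sided distances to [K] are the distances to the ends of the gap. *)
  have [g gG tg] := GP t tab fmt.
  rewrite (Sone g) //; have [[gg Kg1 Kg2 _ _] gK] := Ggap _ gG; have [_ _ H1 _] := HP _ gg.
  suff : 1 <= H g n t by move=> h; rewrite ler_wpDl ?f0 // ler_pMr.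
  apply: H1.
  have nE : ~ enlargement I K eps t.
    by move=> /(fm t tab) h; move: m0; clear -h fmt; lra.
  have It : I t by apply: abI; rewrite /= in_itv.
  move/andP: tg => [g1t tg2].
  have ts : two_sided K t by split; [exists g.1 => //; exact: ltW|exists g.2 => //; exact: ltW].
  have ld : ldist K t = t - g.1.
    apply/eqP; rewrite eq_le; apply/andP; split.
      apply: ge_inf; first by exists 0 => d [].
      by split; [rewrite subr_ge0 ltW|rewrite subKr].
    apply: lb_le_inf; first by exists (t - g.1); split; [rewrite subr_ge0 ltW|rewrite subKr].
    move=> d [d0 Kd]; rewrite leNgt; apply/negP => dt; apply: (gK _ Kd).
    by apply/andP; split; lra.
  have rd : rdist K t = g.2 - t.
    apply/eqP; rewrite eq_le; apply/andP; split.
      apply: ge_inf; first by exists 0 => d [].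
      by split; [rewrite subr_ge0 ltW|rewrite addrC subrK].
    apply: lb_le_inf; first by exists (g.2 - t); split; [rewrite subr_ge0 ltW|rewrite addrC subrK].
    move=> d [d0 Kd]; rewrite leNgt; apply/negP => dt; apply: (gK _ Kd).
    by apply/andP; split; lra.
  have n1 : ~ right_enlargement I K eps t by move=> h; apply: nE; left; right.
  have n2 : ~ left_enlargement I K eps t by move=> h; apply: nE; right.
  have r1 : eps * (t - g.1) < g.2 - t.
    by rewrite ltNge; apply/negP => h; apply: n1; split => //; rewrite ld rd.
  have r2 : eps * (g.2 - t) < t - g.1.
    by rewrite ltNge; apply/negP => h; apply: n2; split => //; rewrite ld rd.
  rewrite /tau mulrAC ler_pdivlMr // -[1 + eps]gtr0_norm // -normrM ler_norml.
  by move: r1 r2; clear; nra.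
Qed.

(** * Newton interpolation with controlled growth *)

Lemma horner_nodal {R : realType} (s : seq R) (t : R) :
  (nodal s).[t] = \prod_(x <- s) (t - x).
Proof. by rewrite /nodal horner_prod; apply: eq_bigr => x _; rewrite hornerXsubC. Qed.

Lemma nodal_bounded {R : realType} (s : seq R) (B : R) :
  exists C : R, forall t, `|t| <= B -> `|(nodal s).[t]| <= C.
Proof.
exists (\prod_(x <- s) (B + `|x|)) => t tB.
rewrite horner_nodal normr_prod; apply: ler_prod => x _.
by rewrite normr_ge0 /=; apply: le_trans (ler_normB _ _) _; rewrite lerD2r.
Qed.

(* Newton interpolation at a near-Leja sequence: each new node maximizes the
   current nodal polynomial over Y up to a factor 2. *)
Lemma leja_interpolation {R : realType} (Y : set R) (F : R -> R) (B d : R) (k : nat) :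
  (forall y, Y y -> `|y| <= B) -> (forall y, Y y -> `|F y| <= d) ->
  (forall s : seq R, (size s < k)%N -> exists2 y, Y y & y \notin s) ->
  exists s : seq R, exists p : {poly R}, [/\ uniq s, size s = k,
    {in s, forall y, Y y}, (size p <= k)%N /\ {in s, forall y, p.[y] = F y} &
    forall t, Y t -> `|F t - p.[t]| <= 4 ^+ k * d].
Proof.
move=> YB Fd Yk.
(* The induction runs on a bound for [p] itself; adding |F| <= d restores the factor 4^k. *)
suff [s [p [us ss sY [sp ps] pd]]] : exists s : seq R, exists p : {poly R},
   [/\ uniq s, size s = k, {in s, forall y, Y y},
       (size p <= k)%N /\ {in s, forall y, p.[y] = F y} &
       forall t, Y t -> `|p.[t]| <= (4 ^+ k - 1) * d].
  exists s, p; split => // t Yt; apply: le_trans (ler_normB _ _) _.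
  by have := lerD (Fd t Yt) (pd t Yt); lra.
elim: k Yk => [_|k ih Yk].
  exists [::], 0; split => //; first by rewrite size_poly0.
  by move=> t _; rewrite horner0 normr0 expr0 subrr mul0r.
have [|s [p [us ss sY [sp ps] pd]]] := ih.
  by move=> s sk; apply: Yk; exact: leqW.
have [y0 Yy0 y0s] : exists2 y, Y y & y \notin s by apply: Yk; rewrite ss.
pose A := [set `|(nodal s).[t]| | t in Y].
have supA : has_sup A.
  split; first by exists `|(nodal s).[y0]|, y0.
  by have [C CP] := nodal_bounded s B; exists C => _ [t Yt <-]; apply/CP/YB.
have N0 t : t \notin s -> 0 < `|(nodal s).[t]|.
  by move=> ts; rewrite normr_gt0 -[_ == 0]/(root _ _) root_nodal.
have sA0 : 0 < sup A.
  by apply: lt_le_trans (N0 _ y0s) _; apply: ub_le_sup; [case: supA|exists y0].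
(* [Y] is only bounded, so the supremum need not be attained; [y] reaches more than half of it. *)
have [_ [y Yy <-] yA] := sup_adherent (divr_gt0 sA0 (ltr0n R 2)) supA.
have yN : 0 < `|(nodal s).[y]| by lra.
have ys : y \notin s by rewrite -root_nodal -[root _ _]/(_ == 0) -normr_gt0.
pose q := p + ((F y - p.[y]) / (nodal s).[y]) *: nodal s.
exists (rcons s y), q; split.
- by rewrite rcons_uniq ys.
- by rewrite size_rcons ss.
- by move=> t; rewrite mem_rcons in_cons => /orP[/eqP->|/sY].
- split.
    rewrite (leq_trans (size_polyD _ _)) // geq_max (leqW sp) /=.
    by rewrite (leq_trans (size_scale_leq _ _)) // size_nodal ss.
  move=> t; rewrite mem_rcons in_cons => /orP[/eqP->|ts].
    by rewrite /q hornerD hornerZ divfK -?normr_gt0 // addrC subrK.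
  have /rootP N1 : root (nodal s) t by rewrite root_nodal.
  by rewrite /q hornerD hornerZ N1 mulr0 addr0 ps.
- move=> t Yt; rewrite /q hornerD hornerZ.
  (* The Newton term added at [y] is at most 2 * 4^k d on [Y], and (4^k - 1) + 2 * 4^k <= 4^(k+1) -
     1. *)
  have tA : `|(nodal s).[t]| <= 2 * `|(nodal s).[y]|.
    have : `|(nodal s).[t]| <= sup A by apply: ub_le_sup; [case: supA|exists t].
    by move: yA; lra.
  apply: le_trans (ler_normD _ _) _; rewrite !normrM normfV.
  have h1 : `|F y - p.[y]| <= 4 ^+ k * d.
    by apply: le_trans (ler_normB _ _) _; have := lerD (Fd y Yy) (pd y Yy); lra.
  have h2 : `|F y - p.[y]| / `|(nodal s).[y]| * `|(nodal s).[t]| <= 4 ^+ k * d * 2.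
    rewrite -mulrA; apply: ler_pM => //.
    by rewrite mulrC ler_pdivrMr.
  have d0 : 0 <= d by apply: le_trans (Fd y Yy).
  have h3 := pd t Yt; rewrite exprS.
  have k1 : (1 : R) <= 4 ^+ k by rewrite exprn_ege1 // ler1n.
  have : 0 <= (4 ^+ k - 1) * d by rewrite mulr_ge0 // subr_ge0.
  by move: d0 h2 h3; set z := _ * `|_.[t]|; set w := 4 ^+ k; clear; nra.
Qed.

(** * A positive lower bound for the levels of nodal polynomials *)

Lemma probability_mono {R : realType} (mu : probability (measurableTypeR R) R)
    (A B : set (measurableTypeR R)) :
  measurable A -> measurable B -> A `<=` B -> (mu A <= mu B)%E.
Proof. by move=> mA mB AB; apply: le_measure; rewrite ?inE. Qed.

Definition sublevel {R : realType} (s : seq R) (l : R) : set R :=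
  [set t | `|(nodal s).[t]| <= l].

Lemma closed_sublevel {R : realType} (s : seq R) (l : R) : closed (sublevel s l).
Proof.
apply: (@preimage_closed R R (Num.norm \o horner (nodal s)) [set x | x <= l]); last exact: closed_le.
by move=> t _; apply: continuous_comp; [exact: continuous_horner|exact: norm_continuous].
Qed.

(** Compactness in the vector of nodes. Small neighbourhoods of the nodes [v] shrink to a set of at
    most k points, so one of them has mass below theta. For nodes close to [v] and a small level,
    the sublevel set lies inside that neighbourhood. *)
Lemma sublevel_pos {R : realType} (mu : probability (measurableTypeR R) R) (K : set R)
    (a b theta : R) (k : nat) :
  closed K -> K `<=` `[a, b]%classic ->
  (forall s : seq R, (size s <= k)%N -> (mu [set` s] < theta%:E)%E) ->
  exists2 l0 : R, 0 < l0 & forall (s : seq R) (l : R), size s = k ->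
    {in s, forall x, K x} ->
    (theta%:E <= mu (K `&` sublevel s l))%E -> l0 <= l.
Proof.
move=> clK Kab mus.
pose sv (v : 'rV[R]_k) := [seq v ord0 i | i <- enum 'I_k].
have Nv v t : (nodal (sv v)).[t] = \prod_(i < k) (t - v ord0 i).
  by rewrite horner_nodal big_map big_enum.
pose P (l : R) (v : 'rV[R]_k) :=
  (mu (K `&` sublevel (sv v) l) < theta%:E)%E.
have mS (v : 'rV[R]_k) l : measurable (K `&` sublevel (sv v) l).
  by apply: closed_measurable; apply: closedI => //; exact: closed_sublevel.
suff loc (v : 'rV[R]_k) : exists2 r : R, 0 < r &
    forall w l, ball v r w -> l < r -> P l w.
  have cpt := @rV_compact R k (fun=> `[a, b]%classic) (fun=> @segment_compact R a b).
  have /compact_near_coveringP cov := cpt.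
  have near0 : \forall l \near (0 : R)^'+, [set v : 'rV[R]_k | forall i, `[a, b]%classic (v ord0 i)] `<=` P l.
    apply: cov => v _; have [r r0 Pr] := loc v.
    exists (ball v r, [set l | l < r]).
      by split; [exact: nbhsx_ballx|exact: nbhs_right_lt].
    by move=> [w l] /= [h1 h2]; exact: (Pr w l h1 h2).
  have [l0 [l00 Pl0]] : exists l, 0 < l /\ ([set v : 'rV[R]_k | forall i, `[a, b]%classic (v ord0 i)] `<=` P l).
    near (0 : R)^'+ => l; exists l; split; near: l; [exact: nbhs_right_gt|exact: near0].
  exists l0 => // s l ss sK; apply: contraTle => ll0; rewrite -ltNge.
  pose v : 'rV[R]_k := \row_i nth 0 s i.
  have svE : sv v = s.
    apply: (@eq_from_nth _ 0); first by rewrite size_map size_enum_ord ss.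
    move=> i; rewrite size_map size_enum_ord => ik.
    rewrite (nth_map (Ordinal ik)) ?size_enum_ord // mxE nth_enum_ord //.
  have := Pl0 v; rewrite /P svE => h.
  apply: le_lt_trans (h _); last first.
    by move=> i /=; apply/Kab/sK; rewrite mxE mem_nth // ss.
  apply: probability_mono.
  - by rewrite -svE; exact: mS.
  - by rewrite -svE; exact: mS.
  - by move=> t [Kt /= tl]; split => //=; apply: le_trans tl (ltW ll0).
(* The closed 1/(j+1)-neighbourhoods of the nodes decrease to the node set, and continuity from
   above transfers the strict bound on the mass. *)
pose U (j : nat) := \bigcup_(i in [set: 'I_k]) [set t : R | `|t - v ord0 i| <= j.+1%:R^-1].
have mU j : measurable (U j).
  apply: fin_bigcup_measurable => // i _; apply: closed_measurable.
  apply: (@preimage_closed R R (fun t => `|t - v ord0 i|) [set x | x <= j.+1%:R^-1]); last exact: closed_le.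
  move=> t _; apply: (@continuous_comp _ _ _ (fun t => t - v ord0 i)); last exact: norm_continuous.
  by apply: continuousB; [exact: cvg_id|exact: cvg_cst].
have [j Uj] : exists j, (mu (U j) < theta%:E)%E.
  have capU : \bigcap_j U j = [set` sv v].
    apply/seteqP; split => [t tU|t].
      apply: contrapT => nt.
      have pos i : 0 < `|t - v ord0 i|.
        rewrite normr_gt0 subr_eq0; apply/eqP => tv; apply: nt.
        by rewrite /= tv; apply/mapP; exists i => //; rewrite mem_enum.
      pose x := \big[Num.min/1]_(i < k) `|t - v ord0 i|.
      have x0 : 0 < x by apply: lt_bigmin.
      have [j jx] : exists j : nat, j.+1%:R^-1 < x.
        exists (Num.truncn x^-1); rewrite invf_plt ?posrE ?ltr0n //.
        exact: truncnS_gt.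
      have [i _ /=] := tU j I; rewrite leNgt => /negP; apply; apply: (lt_le_trans jx).
      exact: bigmin_le_cond.
    move=> /= /mapP[i _ ->] j _; exists i => //=.
    by rewrite subrr normr0 invr_ge0.
  have cvU : (mu \o U) x @[x --> \oo] --> mu (\bigcap_n U n).
    apply: nonincreasing_cvg_mu.
    - by apply: le_lt_trans (probability_le1 _ _) (ltry _); exact: mU.
    - exact: mU.
    - by apply: bigcapT_measurable; exact: mU.
    - move=> i j ij; apply/subsetPset => t [l _ /= tl]; exists l => //=.
      by apply: le_trans tl _; rewrite lef_pV2 ?posrE ?ltr0n // ler_nat ltnS.
  have lt : (mu (\bigcap_n U n) < theta%:E)%E.
    by rewrite capU; apply: mus; rewrite size_map size_enum_ord.
  have [j _ /(_ j) jP] := cvU _ (open_nbhs_nbhs (conj (@open_ereal_lt_ereal R theta%:E) lt)).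
  by exists j; apply: jP => /=.
pose rho : R := j.+1%:R^-1.
have rho0 : 0 < rho by rewrite invr_gt0 ltr0n.
(* If [t] were farther than rho / 2 from every node of [w], the product would be at least (rho /
   2)^k > l. The other half of rho is the distance from the nodes of [w] to those of [v]. *)
exists (Num.min (rho / 2) ((rho / 2) ^+ k)).
  by rewrite lt_min exprn_gt0 ?divr_gt0.
move=> w l; rewrite lt_min => vw /andP[_ lk]; rewrite /P.
apply: le_lt_trans Uj; apply: probability_mono; [exact: mS|exact: mU|].
move=> t [_ /= tl].
have [i ti] : exists i, `|t - w ord0 i| <= rho / 2.
  apply: contrapT => /forallNP h.
  have := le_lt_trans tl lk; rewrite Nv normr_prod ltNge => /negP; apply.
  rewrite -[X in _ ^+ X]card_ord -prodr_const; apply: ler_prod => i _.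
  by rewrite divr_ge0 ?(ltW rho0) //= ltW // ltNge; exact/negP/h.
exists i => //=.
have : ball v (rho / 2) w by apply: le_ball vw; rewrite ge_min lexx.
move=> [_ /(_ ord0 i)]; rewrite /ball /= => vwi.
have -> : t - v ord0 i = (t - w ord0 i) - (v ord0 i - w ord0 i) by ring.
by apply: le_trans (ler_normB _ _) _; rewrite -/rho; lra.
Unshelve. all: by end_near.
Qed.

(** * Roots of polynomials and components of their sublevel sets *)

Lemma scalar_nodal_of_roots {R : realType} (s : seq R) (r : {poly R}) :
  uniq s -> (size r <= (size s).+1)%N -> {in s, forall x, r.[x] = 0} ->
  r = r`_(size s) *: nodal s.
Proof.
move=> us sr rs; apply/eqP; rewrite -subr_eq0; apply/eqP.
have Nlead : (nodal s)`_(size s) = 1.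
  by have := monicP (monic_prod_XsubC s predT id); rewrite lead_coefE size_nodal.
apply: (@roots_geq_poly_eq0 _ _ s) => //.
  apply/allP => x xs; apply/rootP; rewrite hornerD hornerN hornerZ rs //.
  have /rootP -> : root (nodal s) x by rewrite root_nodal.
  by rewrite mulr0 subr0.
apply/leq_sizeP => j; rewrite leq_eqVlt => /orP[/eqP <-|sj].
  by rewrite coefB coefZ Nlead mulr1 subrr.
rewrite coefB coefZ [X in X - _]nth_default ?(leq_trans sr) //.
by rewrite [(nodal s)`_j]nth_default ?size_nodal // mulr0 subr0.
Qed.

(** Reduces counting to finding a collision among n + 1 points. If the image were larger, points
    with distinct values could be chosen one by one: k <= n values never exhaust it. *)
Lemma card_image_le_ordinal {T U : Type} (x0 : T) (E : set T) (f : T -> U) (n : nat) :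
  (forall g : nat -> T, (forall i, (i <= n)%N -> E (g i)) ->
     exists i j, [/\ (i < j)%N, (j <= n)%N & f (g i) = f (g j)]) ->
  (f @` E #<= `I_n)%card.
Proof.
move=> H; apply: contrapT => nE.
have step k : (k <= n.+1)%N -> exists g : nat -> T, (forall i, (i < k)%N -> E (g i)) /\
    forall i j, (i < j)%N -> (j < k)%N -> f (g i) <> f (g j).
  elim: k => [_|k ih kn]; first by exists (fun _ => x0).
  have [g [gE gf]] := ih (ltnW kn).
  have [x Ex xf] : exists2 x, E x & forall i, (i < k)%N -> f x <> f (g i).
    apply: contrapT => /forall2NP h; apply: nE.
    apply: (@card_le_trans _ _ _ `I_k); last by rewrite card_le_II.
    apply: (card_le_trans (B := (f \o g) @` `I_k)); last exact: card_image_le.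
    apply: subset_card_le => _ [x Ex <-].
    have [//|/existsNP[i /not_implyP[ik /contrapT fxi]]] := h x.
    by exists i.
  exists (fun i => if i == k then x else g i); split.
    by move=> i; case: eqP => // /eqP ik; rewrite ltnS leq_eqVlt (negbTE ik) => /gE.
  move=> i j ij; rewrite ltnS leq_eqVlt => /orP[/eqP jk|jk].
    by rewrite jk eqxx ltn_eqF -?jk // => e; apply: (xf i) => //; rewrite -jk.
  by rewrite (ltn_eqF jk) (ltn_eqF (ltn_trans ij jk)); exact: gf.
have [g [gE gf]] := step n.+1 (leqnn _).
have [|i [j [ij jn]]] := H g; first by move=> i; rewrite -ltnS => /gE.
exact: gf.
Qed.

(** The intermediate value theorem gives one root on each side of every point where [p] is negative.
    The induction moves [u0] to the next separating point, which keeps the roots increasing and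
    hence distinct. *)
Lemma poly_alternating_roots {R : realType} (p : {poly R}) (u0 ue x : R) (s : seq R) :
  path (fun x y => (x < y) && `[< exists2 u, x < u < y & 0 < p.[u] >]) x s ->
  all (fun y => p.[y] < 0) (x :: s) -> u0 < x -> 0 < p.[u0] ->
  all (< ue) (x :: s) -> 0 < p.[ue] ->
  exists rs, [/\ size rs = (2 * (size s).+1)%N, path <%R u0 rs & all (root p) rs].
Proof.
have rt a b : a < b -> p.[a] * p.[b] < 0 -> exists2 r, a < r < b & root p r.
  move=> ab pab.
  have [r /andP[ar rb] pr] : exists2 r, a <= r <= b & root p r.
    have [pa|pa] := leP p.[a] 0.
      apply: poly_ivt; first exact: ltW.
      rewrite pa /= leNgt; apply/negP => pb.
      by move: pab; rewrite ltNge mulr_le0 // ltW.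
    have [r rab] : exists2 r, a <= r <= b & root (- p) r.
      apply: poly_ivt; first exact: ltW.
      rewrite !hornerN oppr_le0 (ltW pa) /= oppr_ge0 leNgt; apply/negP => pb.
      by move: pab; rewrite ltNge mulr_ge0 // ltW.
    by rewrite rootN; exists r.
  have pr0 := rootP pr; exists r => //.
  rewrite !lt_neqAle ar rb !andbT; apply/andP; split; apply/eqP => e.
    by move: pab; rewrite e pr0 mul0r ltxx.
  by move: pab; rewrite -e pr0 mulr0 ltxx.
elim: s x u0 => [|y s ih] x u0.
  move=> _ /= /andP[px _] ux pu /andP[xe _] pe.
  have [r1 /andP[ur1 r1x] pr1] : exists2 r, u0 < r < x & root p r.
    by apply: rt => //; rewrite pmulr_rlt0.
  have [r2 /andP[xr2 r2u] pr2] : exists2 r, x < r < ue & root p r.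
    by apply: rt => //; rewrite pmulr_llt0.
  exists [:: r1; r2]; split => //=; last by rewrite pr1 pr2.
  by rewrite ur1 (lt_trans r1x xr2).
move=> /= /andP[/andP[xy /asboolP[u /andP[xu uy] pu]] ys] /andP[px ps] ux pu0 /andP[xe se] pe.
have [r1 /andP[ur1 r1x] pr1] : exists2 r, u0 < r < x & root p r.
  by apply: rt => //; rewrite pmulr_rlt0.
have [r2 /andP[xr2 r2u] pr2] : exists2 r, x < r < u & root p r.
  by apply: rt => //; rewrite pmulr_llt0.
have [rs [srs prs ars]] := ih y u ys ps uy pu se pe.
exists [:: r1, r2 & rs]; split.
- by rewrite /= srs [in RHS]mulnS.
- rewrite /= ur1 (lt_trans r1x xr2) /=.
  by case: rs prs {srs ars} => //= r rs /andP[ur ->]; rewrite (lt_trans r2u ur).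
- by rewrite /= pr1 pr2.
Qed.

(** Points in n + 1 different components would be separated by points where Q > l, and Q > l also
    holds beyond both extremes. A slightly higher level would then be crossed 2(n + 1) times, more
    than the degree allows. *)
Lemma poly_sublevel_components {R : realType} (Q : {poly R}) (n : nat) (l a b : R) :
  (size Q <= (2 * n).+1)%N ->
  (forall T : R, (exists2 t : R, t < T & l < Q.[t]) /\ (exists2 t : R, T < t & l < Q.[t])) ->
  at_most_n_components n [set t | a <= t <= b /\ Q.[t] <= l].
Proof.
move=> sQ Qinf; rewrite /at_most_n_components; set E := [set t | _].
apply: (card_image_le_ordinal 0) => g gE; apply: contrapT => inj.
pose gs := [seq g i | i <- iota 0 n.+1].
have gsE : {in gs, forall x, E x}.
  by move=> _ /mapP[i + ->]; rewrite mem_iota /= add0n ltnS => /gE.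
have comp_inj i j : (i < j)%N -> (j <= n)%N ->
    connected_component E (g i) <> connected_component E (g j).
  by move=> ij jn e; apply: inj; exists i, j.
have ugs : uniq gs.
  rewrite map_inj_in_uniq ?iota_uniq // => i j; rewrite !mem_iota !add0n !ltnS /= => im jm gij.
  case: (ltngtP i j) => // ij; first by have := comp_inj i j ij jm; rewrite gij.
  by have := comp_inj j i ij im; rewrite gij.
(* Without a separating point the whole segment [x, y] lies in [E], so x and y share a component. *)
have sep : {in gs &, forall x y : R, x < y -> exists2 u : R, x < u < y & l < Q.[u]}.
  move=> x y xs ys xy; apply: contrapT => /forall2NP h.
  have xyE : `[x, y]%classic `<=` E.
    move=> t; rewrite /= in_itv /= => /andP[xt ty].
    have [/andP[ax _] Qx] := gsE x xs; have [/andP[_ yb] Qy] := gsE y ys.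
    split; first by rewrite (le_trans ax) ?(le_trans ty).
    have [->//|/eqP tx] := eqVneq t x; have [->//|/eqP ty'] := eqVneq t y.
    have [[]|/negP] := h t; last by rewrite -leNgt.
    by rewrite !lt_neqAle xt ty !andbT; apply/andP; split; apply/eqP => // e; apply: tx.
  have : connected_component E x = connected_component E y.
    apply: same_connected_component; apply: (@connected_component_max _ _ `[x, y]%classic) => //.
    - by rewrite /= in_itv /= lexx ltW.
    - exact: segment_connected.
    - by rewrite /= in_itv /= lexx ltW.
  have [i + gx] := mapP xs; have [j + gy] := mapP ys.
  rewrite !mem_iota !add0n !ltnS /= => jn im; rewrite gx gy.
  case: (ltngtP i j) => [ij|ij|ij] e.
  - exact: (comp_inj i j).
  - by apply: (comp_inj j i).
  - by move: xy; rewrite gx gy ij ltxx.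
pose e (mu x y : R) := (x < y) && `[< exists2 u, x < u < y & mu < Q.[u] >].
have [x [s [xs ss ps]]] : exists (x : R) (s : seq R), [/\ {subset x :: s <= gs}, size s = n & path (e l) x s].
  have : sorted <%R (sort <=%R gs) by rewrite sort_lt_sorted.
  have : size (sort <=%R gs) = n.+1 by rewrite size_sort size_map size_iota.
  have : {subset sort <=%R gs <= gs} by move=> t; rewrite mem_sort.
  case: (sort <=%R gs) => // x s xs [ss] ps; exists x, s; split => //.
  apply: (sub_in_path (P := mem gs)) ps; last by apply/allP.
  by move=> t u tg ug tu; rewrite /e tu; apply/asboolP/sep.
(* Points of [E] may satisfy Q = l, so the level is raised strictly above l while staying below Q at
   the finitely many separating points; [nu] below also takes the two outer points into account. *)
have [mu lmu pmu] : exists2 mu : R, l < mu & path (e mu) x s.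
  elim: s x ps {ss xs} => [|y s ih] x; first by exists (l + 1); rewrite ?ltrDl.
  move=> /= /andP[/andP[xy /asboolP[u xuy lu]] /ih[mu lmu pmu]].
  exists (Num.min mu ((l + Q.[u]) / 2)); first by rewrite lt_min lmu /=; lra.
  apply/andP; split.
    rewrite /e xy; apply/asboolP; exists u => //.
    by apply: le_lt_trans (_ : (l + Q.[u]) / 2 < _); [rewrite ge_min lexx orbT|lra].
  apply: sub_path pmu => t v /andP[tv /asboolP[w tw wmu]]; rewrite /e tv.
  by apply/asboolP; exists w => //; apply: le_lt_trans wmu; rewrite ge_min lexx.
have [u0 u0s Qu0] := (Qinf x).1.
have [ue ues Que] : exists2 ue : R, all (< ue) (x :: s) & l < Q.[ue].
  have [t bt Qt] := (Qinf b).2; exists t => //.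
  by apply/allP => y /xs /gsE [/andP[_ yb] _]; exact: le_lt_trans bt.
pose nu := Num.min mu (Num.min ((l + Q.[u0]) / 2) ((l + Q.[ue]) / 2)).
have lnu : l < nu by rewrite !lt_min lmu /=; apply/andP; split; lra.
have numu : nu <= mu by rewrite ge_min lexx.
have nuu0 : nu < Q.[u0].
  by apply: le_lt_trans (_ : (l + Q.[u0]) / 2 < _); [rewrite !ge_min lexx !orbT|lra].
have nuue : nu < Q.[ue].
  by apply: le_lt_trans (_ : (l + Q.[ue]) / 2 < _); [rewrite !ge_min lexx !orbT|lra].
have [||||||rs [srs prs ars]] := @poly_alternating_roots R (Q - nu%:P) u0 ue x s.
- apply: sub_path pmu => t v /andP[tv /asboolP[w tw wmu]]; rewrite tv.
  by apply/asboolP; exists w => //; rewrite hornerD hornerN hornerC subr_gt0 (le_lt_trans numu).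
- apply/allP => y /xs /gsE [_ Qy]; rewrite hornerD hornerN hornerC subr_lt0.
  exact: le_lt_trans lnu.
- by [].
- by rewrite hornerD hornerN hornerC subr_gt0.
- by [].
- by rewrite hornerD hornerN hornerC subr_gt0.
have urs : uniq rs.
  by have := lt_path_sortedE u0 rs; rewrite prs => /esym/andP[_ /lt_sorted_uniq].
have Q0 : Q - nu%:P != 0.
  apply/eqP => Q0; have := nuu0; rewrite -subr_gt0.
  by have := congr1 (fun p => p.[u0]) Q0; rewrite hornerD hornerN hornerC horner0 => ->; rewrite ltxx.
have := max_poly_roots Q0 ars urs; rewrite srs ss => h.
have : (size (Q - nu%:P)%R <= (2 * n).+1)%N.
  rewrite (leq_trans (size_polyD _ _)) // geq_max sQ size_polyN.
  by rewrite (leq_trans (size_polyC_leq1 _)).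
by move=> /(leq_trans h); rewrite mulnS add2n ltnS ltnNge leqnSn.
Qed.

(** * Expansion of a polynomial along nodal polynomials *)

(** Accumulated loss when the terms of degree k, ..., 1 are removed in turn: removing degree j
    multiplies the bound by 1 + 2 * 4^j. *)
Definition expansion_const {R : realType} (k : nat) : R :=
  \prod_(i < k) (1 + 2 * 4 ^+ i.+1).

Lemma expansion_const_ge1 {R : realType} (k : nat) : 1 <= expansion_const k :> R.
Proof.
rewrite /expansion_const; elim: k => [|k ih]; first by rewrite big_ord0.
rewrite big_ord_recr /= -[1 in leLHS]mulr1 ler_pM // lerDl mulr_ge0 // exprn_ge0 //.
Qed.

(** Induction on the degree. [lead] bounds the top coefficient [a], and where N_{S k.+1} <= 2 Phi
    the remainder p - a N_{S k.+1} is at most (1 + 2 * 4^(k+1)) d. That smaller set is still [big]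
    one degree lower by [shrink]. The conclusion holds at every [t], although [p] is bounded only on
    [Y]. *)
Lemma nodal_expansion_bound {R : realType} (n : nat) (S : nat -> seq R) (Phi : nat -> R)
    (big : nat -> set R -> Prop) :
  (forall k, (k <= n)%N -> size (S k) = k /\ 0 < Phi k) ->
  (forall k Y (p : {poly R}) d, (k <= n)%N -> big k Y -> (size p <= k.+1)%N ->
     (forall t, Y t -> `|p.[t]| <= d) -> `|p`_k| * Phi k <= 4 ^+ k * d) ->
  (forall k Y, (k < n)%N -> big k.+1 Y -> big k (Y `&` sublevel (S k.+1) (2 * Phi k.+1))) ->
  forall k Y (p : {poly R}) d, (k <= n)%N -> big k Y -> (size p <= k.+1)%N ->
    0 <= d -> (forall t, Y t -> `|p.[t]| <= d) ->
    forall t, `|p.[t]| <=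
      expansion_const k * d * \sum_(j < k.+1) `|(nodal (S j)).[t]| / Phi j.
Proof.
move=> SP lead shrink; elim=> [|k ih] Y p d kn bY sp d0 pd t.
  have [s0 P0] := SP 0%N kn; have := lead 0%N Y p d kn bY sp pd.
  rewrite expr0 mul1r => h; rewrite [p in leLHS](size1_polyC sp) hornerC.
  rewrite big_ord_recl big_ord0 addr0 /expansion_const big_ord0 mul1r.
  rewrite (size0nil s0) /nodal big_nil hornerC normr1.
  by rewrite mulrA mulr1 ler_pdivlMr.
have [sk Pk] := SP k.+1 kn; have hl := lead k.+1 Y p d kn bY sp pd.
set a := p`_k.+1 in hl.
pose q := p - a *: nodal (S k.+1).
have sq : (size q <= k.+1)%N.
  apply/leq_sizeP => j; rewrite leq_eqVlt => /orP[/eqP <-|kj].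
    rewrite coefB coefZ.
    have := monicP (monic_prod_XsubC (S k.+1) predT id).
    by rewrite -/(nodal _) lead_coefE size_nodal sk /= => ->; rewrite mulr1 subrr.
  rewrite coefB coefZ [X in X - _]nth_default ?(leq_trans sp) //.
  by rewrite [(nodal _)`_j]nth_default ?size_nodal ?sk // mulr0 subr0.
have d4 : 0 <= 4 ^+ k.+1 * d by rewrite mulr_ge0 ?exprn_ge0.
have qd u : (Y `&` sublevel (S k.+1) (2 * Phi k.+1)) u -> `|q.[u]| <= (1 + 2 * 4 ^+ k.+1) * d.
  move=> [Yu Su]; rewrite /q hornerD hornerN hornerZ.
  apply: le_trans (ler_normB _ _) _; rewrite normrM mulrDl mul1r lerD ?pd //.
  apply: (@le_trans _ _ (`|a| * (2 * Phi k.+1))); first by rewrite ler_wpM2l.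
  by lra.
have q0 : 0 <= (1 + 2 * 4 ^+ k.+1) * d by rewrite mulr_ge0 // addr_ge0 // mulr_ge0 // exprn_ge0.
have := ih _ q _ (ltnW kn) (shrink k Y kn bY) sq q0 qd t.
set X := \sum_(j < k.+1) _ => qt.
have -> : p.[t] = q.[t] + a * (nodal (S k.+1)).[t].
  by rewrite /q hornerD hornerN hornerZ subrK.
rewrite big_ord_recr /= -/X /expansion_const big_ord_recr /= -/(expansion_const k).
apply: le_trans (ler_normD _ _) _; rewrite normrM mulrDr lerD //.
  by apply: le_trans qt _; rewrite mulrA.
rewrite mulrA ler_pdivlMr // mulrAC ler_wpM2r //.
apply: (le_trans hl); rewrite ler_wpM2r //.
have := @expansion_const_ge1 R k; set A := expansion_const k => A1.
have : 1 <= (4 ^+ k.+1 : R) by rewrite exprn_ege1 // ler1n.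
by set w := 4 ^+ k.+1; nra.
Qed.

(** * Sets of large measure and nearly minimal nodes *)

(** Largeness is measured by the mass that is missed, so that these masses add up under
    intersection. *)
Definition large {R : realType} (mu : probability (measurableTypeR R) R) (a : R)
    (A : set R) : Prop :=
  measurable (A : set (measurableTypeR R)) /\ (mu (~` A) <= a%:E)%E.

Lemma largeE {R : realType} (mu : probability (measurableTypeR R) R) (a : R) (A : set R) :
  measurable (A : set (measurableTypeR R)) ->
  (mu (~` A) <= a%:E)%E <-> ((1 - a)%:E <= mu A)%E.
Proof.
move=> mA; have := probability_setC mu mA; have := probability_le1 mu mA.
have : (0 <= mu A)%E by [].
case: (mu A) => [r| |] // _ _ ->.
by rewrite -EFinB !lee_fin; split => ?; lra.
Qed.

Lemma largeI {R : realType} (mu : probability (measurableTypeR R) R) (a b : R) (A B : set R) :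
  large mu a A -> large mu b B -> large mu (a + b) (A `&` B).
Proof.
move=> [mA hA] [mB hB]; split; first exact: measurableI.
rewrite setCI; apply: (le_trans (measureU2 _ _ _)); rewrite ?EFinD ?leeD //.
  exact: measurableC.
exact: measurableC.
Qed.

Lemma large_sub {R : realType} (mu : probability (measurableTypeR R) R) (a b : R) (A B : set R) :
  measurable (B : set (measurableTypeR R)) -> A `<=` B -> a <= b ->
  large mu a A -> large mu b B.
Proof.
move=> mB AB ab [mA hA]; split => //; apply: (@le_trans _ _ a%:E); last by rewrite lee_fin.
apply: le_trans hA; apply: probability_mono; [exact: measurableC|exact: measurableC|].
exact: subsetC.
Qed.

Lemma large_nonempty {R : realType} (mu : probability (measurableTypeR R) R) (a : R) (A : set R) :
  a < 1 -> large mu a A -> A !=set0.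
Proof.
move=> a1 [mA hA]; apply/set0P/eqP => A0; move: hA.
by rewrite A0 setC0 probability_setT lee_fin leNgt a1.
Qed.

(** The segments [-j, j] exhaust the line. Shrinking one of them to the extreme points of the closed
    set K in it loses no mass of K and puts both endpoints in [K], as [fill_gaps] requires. *)
Lemma large_segment {R : realType} (mu : probability (measurableTypeR R) R) (K : set R) (d : R) :
  closed K -> mu (~` K) = 0%E -> 0 < d -> d < 1 ->
  exists a b, [/\ K a, K b & large mu d (K `&` `[a, b]%classic)].
Proof.
move=> clK muK d0 d1.
pose F (j : nat) : set R := `[- j%:R, j%:R]%classic.
have clF j : closed (F j) by exact: interval_closed.
have mF j : measurable (F j : set (measurableTypeR R)) by exact: closed_measurable.
have FT : \bigcup_j F j = setT.
  apply/seteqP; split => // t _; exists (Num.truncn `|t|).+1 => //.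
  by rewrite /F /= in_itv /= -ler_norml ltW // truncnS_gt.
have cvF : (mu \o F) x @[x --> \oo] --> mu (\bigcup_n F n).
  apply: nondecreasing_cvg_mu => //; first by rewrite FT.
  move=> i j ij; apply/subsetPset => t; rewrite /F /= !in_itv /= => /andP[h1 h2].
  have : (i%:R : R) <= j%:R by rewrite ler_nat.
  by move=> ?; apply/andP; split; lra.
have lt : ((1 - d)%:E < mu (\bigcup_n F n))%E by rewrite FT probability_setT lte_fin; lra.
have [j _ /(_ j) jP] := cvF _ (open_nbhs_nbhs (conj (@open_ereal_gt_ereal R (1 - d)%:E) lt)).
have {}jP : ((1 - d)%:E < mu (F j))%E by apply: jP => /=.
have lF : large mu d (F j) by split => //; apply/(largeE _ _ _ (mF j)); exact: ltW.
have lK : large mu 0 K by split; [exact: closed_measurable|rewrite muK].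
have := largeI _ _ _ _ _ lK lF; rewrite add0r => lKF.
have [x [Kx Fx]] := large_nonempty _ _ _ d1 lKF.
have clKF : closed (K `&` F j) by exact: closedI.
have hi : has_inf (K `&` F j).
  by split; [exists x|exists (- j%:R) => y [_]; rewrite /F /= in_itv /= => /andP[]].
have hs : has_sup (K `&` F j).
  by split; [exists x|exists j%:R => y [_]; rewrite /F /= in_itv /= => /andP[]].
exists (inf (K `&` F j)), (sup (K `&` F j)); split.
- by have [] := closed_inf _ clKF hi.
- by have [] := closed_sup _ clKF hs.
- apply: large_sub (lKF) => //.
    by apply: closed_measurable; apply: closedI => //; exact: interval_closed.
  move=> y KFy; split; first by case: KFy.
  rewrite /= in_itv /=; apply/andP; split.
    by apply: ge_inf => //; case: hi.
  by apply: ub_le_sup => //; case: hs.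
Qed.

(** [Phi] acts as a Chebyshev constant of degree k in which a set of mass [e] may be disregarded.
    The factor 2 stands in for the existence of minimizing nodes. *)
Definition near_minimal {R : realType} (mu : probability (measurableTypeR R) R) (K : set R)
    (e : R) (k : nat) (S : seq R) (Phi : R) : Prop :=
  [/\ 0 < Phi, uniq S /\ size S = k, {in S, forall x, K x},
      large mu e (K `&` sublevel S (2 * Phi)) &
      forall s l, uniq s -> size s = k -> {in s, forall x, K x} ->
        large mu e (K `&` sublevel s l) -> Phi <= l].

Lemma closed_seq {R : realType} (s : seq R) : closed [set` s].
Proof.
rewrite (_ : [set` s] = sublevel s 0); first exact: closed_sublevel.
by apply/seteqP; split => t; rewrite /sublevel /= normr_le0 -[_ == 0]/(root _ _) root_nodal.
Qed.

Lemma large_avoids {R : realType} (mu : probability (measurableTypeR R) R) (Y : set R)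
    (e : R) (s : seq R) :
  large mu e Y -> (mu [set` s] < (1 - e)%:E)%E -> exists2 y, Y y & y \notin s.
Proof.
move=> [mY lY] ls; apply: contrapT => /forall2NP h.
move: ls; rewrite ltNge => /negP; apply; apply: (@le_trans _ _ (mu Y)).
  exact/largeE.
apply: probability_mono => //.
  by apply: closed_measurable; exact: closed_seq.
by move=> y Yy /=; have [//|/negP/negbNE] := h y.
Qed.

Lemma segment_norm_bound {R : realType} (a b y : R) : a <= y <= b -> `|y| <= `|a| + `|b|.
Proof.
move=> /andP[ay yb]; rewrite ler_norml.
have := ler_norm (- a); have := ler_norm b; rewrite normrN => h1 h2.
have : 0 <= `|a| by []. have : 0 <= `|b| by [].
by move=> ? ?; apply/andP; split; lra.
Qed.

(** [Phi] is the infimum of the admissible levels: it is positive by [sublevel_pos], and some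
    admissible level is below twice the infimum. *)
Lemma exists_near_minimal {R : realType} (mu : probability (measurableTypeR R) R) (K : set R)
    (a b e : R) (k : nat) :
  closed K -> K `<=` `[a, b]%classic -> large mu e K ->
  (forall s : seq R, (size s <= k)%N -> (mu [set` s] < (1 - e)%:E)%E) ->
  exists S Phi, near_minimal mu K e k S Phi.
Proof.
move=> clK Kab lK mus.
have mS s l : measurable (K `&` sublevel s l : set (measurableTypeR R)).
  by apply: closed_measurable; apply: closedI => //; exact: closed_sublevel.
pose L := [set l : R | exists s : seq R, [/\ uniq s, size s = k, {in s, forall x, K x} &
   large mu e (K `&` sublevel s l)]].
have [l0 l00 l0P] := sublevel_pos mu K a b (1 - e) k clK Kab mus.
have lbL l : L l -> l0 <= l.
  by move=> [s [us ss sK [_ ls]]]; apply: (l0P s) => //; exact/largeE.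
have Kbd y : K y -> `|y| <= `|a| + `|b| by move=> /Kab; exact: segment_norm_bound.
have L0 : L !=set0.
  (* Interpolating the zero function serves to produce k distinct points of [K]; at a level bounding
     their nodal polynomial on [K], the sublevel set is all of [K]. *)
  have [||s [p [us ss sK _ _]]] := leja_interpolation K (cst 0) _ 0 k Kbd.
  - by move=> y _; rewrite normr0.
  - by move=> s sk; apply: large_avoids lK _; apply: mus; exact: ltnW.
  have [C CP] := nodal_bounded s (`|a| + `|b|).
  exists C, s; split => //; rewrite (_ : _ `&` _ = K) //.
  by apply/seteqP; split => [y []//|y Ky]; split => //; apply/CP/Kbd.
have hL : has_inf L by split => //; exists l0.
have P0 : 0 < inf L by apply: lt_le_trans l00 _; exact: lb_le_inf.
have [l [s [us ss sK ls]] linf] := inf_adherent P0 hL.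
exists s, (inf L); split => //.
- apply: large_sub ls => // t [Kt tl]; split => //.
  by rewrite /sublevel /= in tl *; apply: (le_trans tl); lra.
- move=> s' l' us' ss' sK' ls'; apply: ge_inf; first by case: hL.
  by exists s'.
Qed.

(** At near-Leja nodes [s] of [Y], kap |N_s| <= |F - p| <= 4^k d on [Y]. So [Y] lies in the sublevel
    set of N_s at level 4^k d / kap, which is therefore admissible and at least [Phi]. *)
Lemma near_minimal_lower {R : realType} (mu : probability (measurableTypeR R) R) (K Y : set R)
    (a b e : R) (k : nat) (S : seq R) (Phi kap d : R) (F : R -> R) :
  closed K -> K `<=` `[a, b]%classic ->
  (forall s : seq R, (size s <= k)%N -> (mu [set` s] < (1 - e)%:E)%E) ->
  near_minimal mu K e k S Phi ->
  Y `<=` K -> large mu e Y -> (forall t, Y t -> `|F t| <= d) -> 0 <= d ->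
  (forall (s : seq R) (q : {poly R}), uniq s -> size s = k -> {in s, forall x, Y x} ->
     (size q <= k)%N -> {in s, forall x, q.[x] = F x} ->
     forall t, Y t -> kap * `|(nodal s).[t]| <= `|F t - q.[t]|) ->
  kap * Phi <= 4 ^+ k * d.
Proof.
move=> clK Kab mus [P0 _ _ _ minP] YK lY Fd d0 kapF.
have Ybd y : Y y -> `|y| <= `|a| + `|b| by move=> /YK/Kab; exact: segment_norm_bound.
have [|s [p [us ss sY [sp ps] pd]]] := leja_interpolation Y F _ d k Ybd Fd.
  by move=> s sk; apply: large_avoids lY _; apply: mus; exact: ltnW.
have [kap1|kap1] := leP kap 0.
  apply: (@le_trans _ _ 0); first by rewrite mulr_le0_ge0 // ltW.
  by rewrite mulr_ge0 ?exprn_ge0.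
rewrite mulrC -ler_pdivlMr //; apply: (minP s) => //.
  by move=> x /sY/YK.
apply: large_sub lY => //.
  by apply: closed_measurable; apply: closedI => //; exact: closed_sublevel.
move=> t Yt; split; first exact: YK.
rewrite /sublevel /= ler_pdivlMr // mulrC.
by apply: le_trans (pd t Yt); exact: kapF.
Qed.

(** * The level polynomial and the bound on its sublevel set *)

Lemma exists_interpolant {R : realType} (F : R -> R) (s : seq R) : uniq s ->
  exists2 p : {poly R}, (size p <= size s)%N & {in s, forall x, p.[x] = F x}.
Proof.
elim: s => [|y s ih] /=; first by exists 0; rewrite ?size_poly0.
move=> /andP[ys /ih[p sp ps]].
have N0 : (nodal s).[y] != 0 by rewrite -[_ == 0]/(root _ _) root_nodal.
exists (p + ((F y - p.[y]) / (nodal s).[y]) *: nodal s).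
  rewrite (leq_trans (size_polyD _ _)) // geq_max (leqW sp) /=.
  by rewrite (leq_trans (size_scale_leq _ _)) // size_nodal.
move=> t; rewrite in_cons hornerD hornerZ => /orP[/eqP->|ts].
  by rewrite divfK // addrC subrK.
have /rootP -> : root (nodal s) t by rewrite root_nodal.
by rewrite mulr0 addr0 ps.
Qed.

(** Squares keep the sum of the relative sizes a polynomial. From here on the order is n.+1, so m =
    n.+2 takes in all degrees 0, ..., n.+1. *)
Definition level_poly {R : realType} (m : nat) (S : nat -> seq R) (Phi : nat -> R) : {poly R} :=
  \sum_(j < m) ((Phi j)^-1 *: nodal (S j)) ^+ 2.

Lemma horner_level_poly {R : realType} (m : nat) (S : nat -> seq R) (Phi : nat -> R) (t : R) :
  (level_poly m S Phi).[t] = \sum_(j < m) ((nodal (S j)).[t] / Phi j) ^+ 2.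
Proof.
rewrite /level_poly horner_sum; apply: eq_bigr => j _.
by rewrite horner_exp hornerZ mulrC.
Qed.

Lemma level_poly_ge {R : realType} (m : nat) (S : nat -> seq R) (Phi : nat -> R) (t : R) (j : nat) :
  (j < m)%N -> ((nodal (S j)).[t] / Phi j) ^+ 2 <= (level_poly m S Phi).[t].
Proof.
move=> jm; rewrite horner_level_poly (bigD1 (Ordinal jm)) //= lerDl.
by apply: sumr_ge0 => i _; exact: sqr_ge0.
Qed.

(** The degree is at most 2 n.+1, and the top term alone exceeds any level far out on both sides:
    beyond [B + 1 + y] each of its factors is at least 1 + y. *)
Lemma level_poly_components {R : realType} (n : nat) (S : nat -> seq R) (Phi : nat -> R) (l a b : R) :
  (forall k, (k <= n.+1)%N -> size (S k) = k) -> 0 < Phi n.+1 ->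
  at_most_n_components n.+1 [set t | a <= t <= b /\ (level_poly n.+2 S Phi).[t] <= l].
Proof.
move=> sS P0; apply: poly_sublevel_components.
  rewrite /level_poly; apply: (leq_trans (size_sum _ _ _)); apply/bigmax_leqP => j _.
  apply: (leq_trans (size_poly_exp_leq _ _)); rewrite ltnS mulnC leq_mul2l /=.
  rewrite -subn1 leq_subLR; apply: (leq_trans (size_scale_leq _ _)).
  by rewrite size_nodal sS ?ltn_ord // -ltnS.
move=> T.
pose y := Phi n.+1 * (`|l| + 1).
have y0 : 0 < y by rewrite mulr_gt0 // ltr_pwDr.
pose B := \sum_(x <- S n.+1) `|x|.
have SB x : x \in S n.+1 -> `|x| <= B.
  by move=> xS; rewrite /B (big_rem x) //= lerDl sumr_ge0.
have B0 : 0 <= B by exact: sumr_ge0.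
have far t : B + 1 + y <= `|t| -> l < (level_poly n.+2 S Phi).[t].
  move=> Bt; apply: (lt_le_trans _ (level_poly_ge _ _ _ _ n.+1 (ltnSn _))).
  have yN : y <= `|(nodal (S n.+1)).[t]|.
    rewrite horner_nodal normr_prod.
    have d x : x \in S n.+1 -> 1 + y <= `|t - x|.
      by move=> /SB xB; apply: le_trans (lerB_dist _ _); lra.
    apply: (@le_trans _ _ (\prod_(x <- S n.+1) (1 + y))).
      rewrite big_const_seq count_predT sS // iter_mulr_1.
      apply: (@le_trans _ _ (1 + y)); first by rewrite lerDr.
      by rewrite exprS ler_peMr ?exprn_ege1 ?lerDl ?addr_ge0 // ltW.
    rewrite big_seq [leRHS]big_seq; apply: ler_prod => x xS.
    by rewrite d // andbT addr_ge0 // ltW.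
  have h1 : `|l| + 1 <= `|(nodal (S n.+1)).[t] / Phi n.+1|.
    by rewrite normrM normfV (gtr0_norm P0) ler_pdivlMr // mulrC.
  rewrite -[X in _ < X]real_normK ?num_real //.
  have l1 : l <= `|l| by exact: ler_norm.
  have l0 : 0 <= `|l| by [].
  by move: h1 l1 l0; set w := `|_ / _|; set v := `|l|; clear; nra.
have T0 : 0 <= `|T| by []. have T1 := ler_norm T. have T2 := ler_norm (- T).
rewrite normrN in T2.
split.
  exists (- (B + 1 + y + `|T| + 1)); first by lra.
  by apply: far; rewrite normrN ger0_norm; lra.
exists (B + 1 + y + `|T| + 1); first by lra.
by apply: far; rewrite ger0_norm; lra.
Qed.

(* The exceptional masses eta 2^(n+1-k) double each time k drops, because peeling
   off the term of degree k.+1 intersects two sets that are large at level k.+1. *)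
Lemma node_sublevel_bound {R : realType} (n : nat) (eps : R) : 0 < eps -> eps < 1 ->
  exists2 A : R, 0 < A & forall (mu : probability (measurableTypeR R) R) (I K : set R)
    (a b eta : R) (S : nat -> seq R) (Phi : nat -> R),
    closed K -> K a -> K b -> `[a, b]%classic `<=` I -> 0 <= eta ->
    (forall k, (k <= n.+1)%N ->
       near_minimal mu (K `&` `[a, b]%classic) (eta * 2 ^+ (n.+1 - k)) k (S k) (Phi k)) ->
    (forall k (s : seq R), (k <= n.+1)%N -> (size s <= k)%N ->
       (mu [set` s] < (1 - eta * 2 ^+ (n.+1 - k))%:E)%E) ->
    forall (f : nat -> R -> R) (M C d : R) (Y : set R),
      jet n.+1 I f -> {in `[a, b], continuous (f n.+1)} ->
      (forall t, a <= t <= b -> 0 <= f n.+1 t <= M) -> 1 <= C ->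
      (forall t, a <= t <= b -> enlargement I K eps t -> M <= C * f n.+1 t) ->
      Y `<=` K `&` `[a, b]%classic -> large mu eta Y -> 0 <= d ->
      (forall t, Y t -> `|f 0%N t| <= d) ->
      forall t, a <= t <= b -> (level_poly n.+2 S Phi).[t] <= 4 * n.+2%:R ->
      `|f 0%N t| <= A * C * d.
Proof.
move=> e0 e1; have [c0 c00 fill] := fill_gaps n.+1 eps e0 e1.
pose B : R := n.+1`!%:R / c0 * 4 ^+ n.+1.
have fa0 : (0 : R) < n.+1`!%:R by rewrite ltr0n fact_gt0.
have fa1 : (1 : R) <= n.+1`!%:R by rewrite ler1n fact_gt0.
have B0 : 0 < B by rewrite !mulr_gt0 ?invr_gt0 ?exprn_gt0.
(* On the sublevel set each |N_{S k}| / Phi k has square at most 4 (n + 2), so it is at most [N]. *)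
pose N : R := 2 * n.+2%:R.
have N1 : 1 <= N by rewrite /N; have : (1 : R) <= n.+2%:R by [rewrite ler1n]; lra.
have E1 := @expansion_const_ge1 R n.
have E0 : 0 < expansion_const n :> R by exact: lt_le_trans E1.
have N0 : 0 < N by exact: lt_le_trans N1.
(* The first summand bounds the interpolation polynomial of [f], expanded into n + 1 terms of
   relative size at most [N]; the second bounds the interpolation error. *)
exists (expansion_const n * (1 + 2 * B) * (n.+1%:R * N) + B * N).
  by repeat first [done | apply: addr_gt0 | apply: mulr_gt0].
move=> mu I K a b eta S Phi clK Ka Kb abI eta0 nm mus f M C d Y jf cf fM C1 fC YK lY d0 fd t tab Qt.
set K0 := K `&` `[a, b]%classic in nm YK.
have clK0 : closed K0 by apply: closedI => //; exact: interval_closed.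
have K0ab : K0 `<=` `[a, b]%classic by move=> x [].
have abItv : is_interval (`[a, b]%classic : set R).
  exact: interval_is_interval.
have [y [Yy _]] : exists y, Y y /\ y \notin ([::] : seq R).
  have : (mu [set` ([::] : seq R)] < (1 - eta)%:E)%E.
    by have := mus n.+1 [::] (leqnn _) isT; rewrite subnn expr0 mulr1.
  by move=> /(large_avoids _ _ _ _ lY)[y Yy yn]; exists y.
have aab : `[a, b]%classic a by have /K0ab := YK y Yy; rewrite /= !in_itv /= lexx => /andP[/le_trans]; exact.
have M0 : 0 <= M by have /andP[h1 h2] := fM a aab; exact: le_trans h2.
have [P0 [uS sS] SK lS _] := nm n.+1 (leqnn _).
rewrite subnn expr0 mulr1 in lS.
have C0 : 0 < C by exact: lt_le_trans C1.
(* [D] agrees with [f] on [K] and its top derivative is at least c0 M / C on [a, b], so the error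
   formula for [D] supplies the hypothesis of [near_minimal_lower] for [f]. Filling the gaps takes a
   positive lower bound, hence the separate case M <= 0. *)
have MPhi : M * Phi n.+1 <= B * C * d.
  have [M1|M1] := leP M 0.
    apply: (@le_trans _ _ 0); first by rewrite mulr_le0_ge0 // ltW.
    by repeat first [done | exact: ltW | rewrite invr_ge0 | apply: mulr_ge0].
  have [|||||||||D [jD D0 Dn]] := fill I K f a b (M / C).
  - exact: clK.
  - exact: Ka.
  - exact: Kb.
  - exact: abI.
  - exact: jf.
  - exact: cf.
  - by move=> u /fM /andP[].
  - by rewrite divr_gt0.
  - by move=> u uab /(fC u uab); rewrite ler_pdivrMr // mulrC.
  have jDab : jet n.+1 `[a, b]%classic D by move=> k kn u uab; apply: jD => //; exact: abI.
  have kap : (c0 * (M / C) / n.+1`!%:R) * Phi n.+1 <= 4 ^+ n.+1 * d.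
    have nmn := nm n.+1 (leqnn _); rewrite subnn expr0 mulr1 in nmn.
    apply: (near_minimal_lower mu K0 Y a b eta n.+1 (S n.+1) (Phi n.+1) _ d (f 0%N)) => //.
      by move=> s sn; have := mus n.+1 s (leqnn _) sn; rewrite subnn expr0 mulr1.
    move=> s q us ss sY sq qs u Yu.
    have [||||||||xi xiab] := interpolation_error n.+1 `[a, b]%classic D s q u.
    - exact: abItv.
    - exact: jDab.
    - exact: us.
    - exact: ss.
    - by move=> x /sY/YK/K0ab.
    - exact: sq.
    - by move=> x xs; rewrite qs // D0 //; have [] := YK _ (sY _ xs).
    - by have /K0ab := YK u Yu.
    rewrite D0; last by have [] := YK _ Yu.
    move=> ->; rewrite normrM ler_wpM2r // ger0_norm; last first.
      rewrite divr_ge0 // ?(ltW fa0) //; apply: le_trans (Dn _ xiab).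
      by repeat first [done | exact: ltW | rewrite invr_ge0 | apply: mulr_ge0].
    by rewrite ler_wpM2r ?invr_ge0 ?(ltW fa0) // Dn.
  have -> : M * Phi n.+1 = (c0 * (M / C) / n.+1`!%:R * Phi n.+1) * (n.+1`!%:R / c0 * C).
    by field; rewrite !gt_eqF.
  have -> : B * C * d = 4 ^+ n.+1 * d * (n.+1`!%:R / c0 * C) by rewrite /B; ring.
  apply: ler_wpM2r => //.
  by repeat first [done | exact: ltW | rewrite invr_ge0 | apply: mulr_ge0].
have [g sg gS] := exists_interpolant (f 0%N) (S n.+1) uS.
rewrite sS in sg.
have jfab : jet n.+1 `[a, b]%classic f by move=> k kn u uab; apply: jf => //; exact: abI.
have fg u : a <= u <= b -> `|f 0%N u - g.[u]| <= M * `|(nodal (S n.+1)).[u]|.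
  move=> uab.
  have [||||||||xi xiab ->] := interpolation_error n.+1 `[a, b]%classic f (S n.+1) g u.
  - exact: abItv.
  - exact: jfab.
  - exact: uS.
  - exact: sS.
  - by move=> x /SK/K0ab.
  - exact: sg.
  - exact: gS.
  - exact: uab.
  have /andP[h1 h2] := fM xi xiab.
  rewrite normrM ler_wpM2r // ger0_norm; last by rewrite divr_ge0 // ltW.
  by rewrite ler_pdivrMr //; apply: (le_trans h2); rewrite ler_peMr.
(* Bound for [g] on the part of [Y] where N_{S n.+1} <= 2 Phi: there |g| <= |f| + M |N_{S n.+1}|. *)
pose d' := d + 2 * (M * Phi n.+1).
have d'0 : 0 <= d' by rewrite addr_ge0 // !mulr_ge0 // ltW.
have X k : (k <= n.+1)%N -> `|(nodal (S k)).[t]| / Phi k <= N.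
  move=> kn; have [Pk _ _ _ _] := nm k kn.
  have -> : `|(nodal (S k)).[t]| / Phi k = `|(nodal (S k)).[t] / Phi k|.
    by rewrite normrM normfV (gtr0_norm Pk).
  have := le_trans (level_poly_ge _ S Phi t k (kn : (k < n.+2)%N)) Qt.
  rewrite -[X in X <= _]real_normK ?num_real // => h.
  rewrite -(ler_pXn2r (n := 2)) ?nnegrE //; last by lra.
  apply: (le_trans h); rewrite /N; have : (1 : R) <= n.+2%:R by rewrite ler1n.
  by set w := n.+2%:R; clear; nra.
have gt : `|g.[t]| <= expansion_const n * d' * (n.+1%:R * N).
  pose big k (Z : set R) := Z `<=` K0 /\ large mu (eta * 2 ^+ (n.+1 - k)) Z.
  have size_nodes k : (k <= n)%N -> size (S k) = k /\ 0 < Phi k.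
    by move=> kn; have [Pk [_ ->] _ _ _] := nm k (leqW kn).
  (* Here [near_minimal_lower] is applied to [p] itself: [p] minus an interpolant of degree below k
     is exactly p_k N_s, so kap = |p_k|. *)
  have leading k Z (p : {poly R}) (e : R) : (k <= n)%N -> big k Z -> (size p <= k.+1)%N ->
      (forall u, Z u -> `|p.[u]| <= e) -> `|p`_k| * Phi k <= 4 ^+ k * e.
    move=> kn [ZK lZ] sp pe.
    have musk s : (size s <= k)%N -> (mu [set` s] < (1 - eta * 2 ^+ (n.+1 - k))%:E)%E.
      exact: mus (leqW kn).
    have [z Zz _] := large_avoids _ _ _ [::] lZ (musk [::] isT).
    apply: (near_minimal_lower mu K0 Z a b _ k (S k) (Phi k) _ e (horner p)) lZ _ _ _ => //.
    - exact: nm (leqW kn).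
    - exact: le_trans (pe z Zz).
    - move=> s q us ss _ sq qs u _.
      have := scalar_nodal_of_roots s (p - q) us.
      rewrite ss coefB [q`_k]nth_default // subr0 => pq.
      rewrite -hornerN -hornerD pq ?hornerZ ?normrM //.
        rewrite (leq_trans (size_polyD _ _)) // geq_max sp size_polyN.
        exact: leqW.
      by move=> x xs; rewrite hornerD hornerN qs // subrr.
  have shrink k Z : (k < n)%N -> big k.+1 Z ->
      big k (Z `&` sublevel (S k.+1) (2 * Phi k.+1)).
    move=> kn [ZK lZ]; split; first by move=> u [/ZK].
    have [_ _ _ lSk _] := nm k.+1 (leqW kn).
    have := largeI _ _ _ _ _ lZ lSk.
    have -> : Z `&` (K0 `&` sublevel (S k.+1) (2 * Phi k.+1)) =
        Z `&` sublevel (S k.+1) (2 * Phi k.+1).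
      by rewrite setIA; congr (_ `&` _); apply/seteqP; split => [u []//|u Zu]; split => //; exact: ZK.
    suff -> : eta * 2 ^+ (n.+1 - k) = eta * 2 ^+ (n.+1 - k.+1) + eta * 2 ^+ (n.+1 - k.+1) by [].
    by rewrite subSS subSn ?(ltnW kn) // exprS; ring.
  have gd u : (Y `&` sublevel (S n.+1) (2 * Phi n.+1)) u -> `|g.[u]| <= d'.
    move=> [Yu Su]; have uab : a <= u <= b by have := K0ab _ (YK _ Yu); rewrite /= in_itv.
    rewrite -[g.[u]](subrK (f 0%N u)) addrC /d'; apply: (le_trans (ler_normD _ _)).
    rewrite lerD ?fd // distrC; apply: (le_trans (fg u uab)).
    by rewrite mulrCA; apply: ler_wpM2l.
  (* Two sets that miss mass [eta] meet in a set missing at most 2 eta, the allowance at degree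
     n. *)
  have bigY : big n (Y `&` sublevel (S n.+1) (2 * Phi n.+1)).
    split; first by move=> u [/YK].
    have := largeI _ _ _ _ _ lY lS.
    have -> : Y `&` (K0 `&` sublevel (S n.+1) (2 * Phi n.+1)) =
        Y `&` sublevel (S n.+1) (2 * Phi n.+1).
      by rewrite setIA; congr (_ `&` _); apply/seteqP; split => [u []//|u Yu]; split => //; exact: YK.
    by rewrite subSnn expr1 mulr_natr mulr2n.
  apply: (le_trans (nodal_expansion_bound n S Phi big size_nodes leading shrink n _ g d' (leqnn _) bigY sg d'0 gd t)).
  apply: ler_wpM2l; first by rewrite mulr_ge0 // ltW.
  apply: (@le_trans _ _ (\sum_(j < n.+1) N)).
    by apply: ler_sum => j _; apply: X; rewrite ltnW.
  by rewrite sumr_const card_ord mulr_natl.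
have ft : `|f 0%N t| <= `|g.[t]| + M * `|(nodal (S n.+1)).[t]|.
  rewrite -[f 0%N t](subrK g.[t]) addrC; apply: (le_trans (ler_normD _ _)).
  by rewrite lerD2l; exact: fg.
apply: (le_trans ft); rewrite 2!mulrDl lerD //.
  apply: (le_trans gt).
  have -> : expansion_const n * (1 + 2 * B) * (n.+1%:R * N) * C * d =
      expansion_const n * (C * d + 2 * (B * C * d)) * (n.+1%:R * N) by ring.
  apply: ler_wpM2r; first by rewrite mulr_ge0 // ltW.
  apply: ler_wpM2l; first exact: ltW.
  rewrite /d' lerD //; first by rewrite ler_peMl.
  by apply: ler_wpM2l.
have -> : M * `|(nodal (S n.+1)).[t]| = M * Phi n.+1 * (`|(nodal (S n.+1)).[t]| / Phi n.+1).
  by field; rewrite gt_eqF.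
have -> : B * N * C * d = B * C * d * N by ring.
apply: ler_pM => //; first by rewrite mulr_ge0 // ltW.
  by rewrite divr_ge0 // ltW.
exact: X.
Qed.

(** * Control by the integral: atomic and diffuse measures *)

(** Pointwise and division-free form of the desired inequality, for integrals with a real value [J];
    an infinite integral is dealt with in the theorem. *)
Definition controls {R : realType} (mu : probability (measurableTypeR R) R) (n : nat)
    (I K : set R) (eps c : R) (E : set R) : Prop :=
  forall (C : R) (f : R -> R), 1 <= C ->
    polynomial_type n (enlargement I K eps) I C f ->
    forall J : R, (\int[mu]_(t in I) (`|f t|)%:E = J%:E)%E ->
    forall t, E t -> c * `|f t| <= C * J.

Lemma measure_light_seq {R : realType} (mu : probability (measurableTypeR R) R) (th : R)
    (s : seq R) :
  {in s, forall x, (mu [set x] <= th%:E)%E} -> (mu [set` s] <= ((size s)%:R * th)%:E)%E.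
Proof.
elim: s => [|x s ih] sth.
  rewrite (_ : [set` [::]] = set0) ?measure0 ?mul0r //.
  by apply/seteqP; split.
have -> : [set` x :: s] = [set x] `|` [set` s].
  apply/seteqP; split => y /=; rewrite in_cons.
    by move=> /orP[/eqP->|ys]; [left|right].
  by move=> [->|->]; rewrite ?eqxx ?orbT.
apply: (le_trans (measureU2 _ _ _)).
- exact: measurable_set1.
- by apply: closed_measurable; exact: closed_seq.
have -> : (size (x :: s))%:R * th = th + (size s)%:R * th by rewrite /= -natr1; ring.
rewrite EFinD leeD //.
  by apply: sth; rewrite mem_head.
by apply: ih => y ys; apply: sth; rewrite in_cons ys orbT.
Qed.

Lemma measurable_superlevel {R : realType} (I : set R) (f : R -> R) (d : R) :
  open I -> {in I, continuous f} ->
  measurable (I `&` [set t : R | (d <= `|f t|)%R] : set (measurableTypeR R)).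
Proof.
move=> oI cf; have mI : measurable (I : set (measurableTypeR R)) by exact: open_measurable.
have mf : measurable_fun (I : set (measurableTypeR R)) f by exact: open_continuous_measurable_fun.
apply: (mf mI [set x | d <= `|x|]); apply: closed_measurable.
apply: (@preimage_closed R R Num.norm [set x | d <= x]); last exact: closed_ge.
by move=> x _; exact: norm_continuous.
Qed.

Lemma markov_on {R : realType} (mu : probability (measurableTypeR R) R) (I : set R)
    (f : R -> R) (d e : R) :
  open I -> {in I, continuous f} -> 0 < d ->
  (\int[mu]_(t in I) (`|f t|)%:E <= (d * e)%:E)%E ->
  (mu (I `&` [set t : R | (d <= `|f t|)%R]) <= e%:E)%E.
Proof.
move=> oI cf d0 fde.
have mI : measurable (I : set (measurableTypeR R)) by exact: open_measurable.
have mf : measurable_fun (I : set (measurableTypeR R)) f by exact: open_continuous_measurable_fun.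
have := @le_integral_abse _ _ _ mu I mI (EFin \o f) d.
have mg : measurable_fun (I : set (measurableTypeR R)) (EFin \o f) by exact/measurable_EFinP.
move=> /(_ mg d0) h.
rewrite -(@lee_pmul2l _ d%:E) ?lte_fin //.
apply: (le_trans h) => //.
Qed.

Lemma large_small_values {R : realType} (mu : probability (measurableTypeR R) R) (I K : set R)
    (f : R -> R) (d e e' : R) :
  open I -> K `<=` I -> {in I, continuous f} -> 0 < d ->
  (\int[mu]_(t in I) (`|f t|)%:E <= (d * e)%:E)%E ->
  large mu e' K -> large mu (e' + e) (K `&` [set t | `|f t| <= d]).
Proof.
move=> oI KI cf d0 fde [mK lK].
have mI : measurable (I : set (measurableTypeR R)) by exact: open_measurable.
have mf : measurable_fun (I : set (measurableTypeR R)) f by exact: open_continuous_measurable_fun.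
have mY : measurable (K `&` [set t | `|f t| <= d] : set (measurableTypeR R)).
  have -> : K `&` [set t | `|f t| <= d] = K `&` (I `&` f @^-1` [set x | `|x| <= d]).
    by apply/seteqP; split => t; [move=> [Kt ft]; split => //; split => //; exact: KI|move=> [Kt []]].
  apply: measurableI => //; apply: mf => //; apply: closed_measurable.
  apply: (@preimage_closed R R Num.norm [set x | x <= d]); last exact: closed_le.
  by move=> x _; exact: norm_continuous.
split => //; have mM := measurable_superlevel I f d oI cf.
apply: (@le_trans _ _ (mu (~` K `|` (I `&` [set t : R | (d <= `|f t|)%R])))).
  apply: probability_mono; [exact: measurableC|apply: measurableU => //; exact: measurableC|].
  move=> t; have [Kt|] := pselect (K t); last by left.
  move=> nY; right; split; first exact: KI.
  by rewrite /= leNgt; apply/negP => fd; apply: nY; split => //=; exact: ltW.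
apply: (le_trans (measureU2 _ _ _)) => //; first exact: measurableC.
by rewrite EFinD leeD //; exact: markov_on.
Qed.

Lemma polynomial_type_continuous {R : realType} (n : nat) (S I : set R) (C : R) (f : R -> R) :
  polynomial_type n.+1 S I C f -> {in I, continuous f}.
Proof.
move=> [[df _] _ _] t /set_mem It.
by apply/differentiable_continuous/derivable1_diffP; exact: (df 0%N isT).
Qed.

(** Passing to -f if necessary makes the n-th derivative nonnegative. [M] is the supremum of its
    absolute value, finite because C |f^(n)(t0)| bounds it at the point [t0] of [S]. *)
Lemma polynomial_type_jet {R : realType} (n : nat) (S I : set R) (C : R) (f : R -> R) (t0 : R) :
  I t0 -> S t0 -> 0 <= C -> polynomial_type n S I C f ->
  exists F M, [/\ jet n I F, {in I, continuous (F n)}, forall t, I t -> 0 <= F n t <= M,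
    forall t, S t -> I t -> M <= C * F n t & forall t, `|F 0%N t| = `|f t|].
Proof.
move=> It0 St0 C0 [[df cf] sgn supinf].
pose g k t := derive1n k f t.
have jg : jet n I g.
  by move=> k kn t It; apply: DeriveDef; [exact: df|rewrite /g derive1nS derive1E].
set sup_ := ereal_sup _ in supinf.
have supge t : I t -> ((`|g n t|)%:E <= sup_)%E by move=> It; apply: ereal_sup_ubound; exists t.
have suple t : S t -> (sup_ <= (C * `|g n t|)%:E)%E.
  move=> St; apply: (le_trans supinf); rewrite EFinM; apply: lee_wpmul2l; first by rewrite lee_fin.
  by apply: ereal_inf_lbound; exists t.
have [M supM] : exists M, sup_ = M%:E.
  have := supge t0 It0; have := suple t0 St0.
  by case: sup_ {supge suple supinf} => [M _ _|//|//]; exists M.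
have key (F : nat -> R -> R) : jet n I F -> {in I, continuous (F n)} ->
    (forall t, I t -> F n t = `|g n t|) -> (forall t, `|F 0%N t| = `|f t|) ->
  exists F M, [/\ jet n I F, {in I, continuous (F n)}, forall t, I t -> 0 <= F n t <= M,
    forall t, S t -> I t -> M <= C * F n t & forall t, `|F 0%N t| = `|f t|].
  move=> jF cF FE F0; exists F, M; split => //.
  - by move=> t It; rewrite FE // normr_ge0 /= -lee_fin -supM; exact: supge.
  - by move=> t St It; rewrite FE // -lee_fin -supM; exact: suple.
case: sgn => sgn.
  apply: (key g) => //.
  - by move=> t /set_mem It; exact: cf.
  - by move=> t It; rewrite ger0_norm //; exact: sgn.
apply: (key (fun k => - g k)).
- by move=> k kn t It; apply: is_deriveN; exact: jg.
- by move=> t /set_mem It; apply: continuousN; exact: cf.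
- by move=> t It; rewrite ler0_norm //; exact: sgn.
- by move=> t; rewrite -[(- g 0%N) t]/(- f t) normrN.
Qed.

(** [E] keeps the points of [s] of mass at least eps / (2 n.+1); the others have total mass at most
    eps / 2. At a kept point x, Markov's inequality at the threshold |f x| compares its mass with J
    / |f x|. *)
Lemma atomic_case {R : realType} (mu : probability (measurableTypeR R) R) (n : nat)
    (I K : set R) (eps : R) (s : seq R) :
  0 < eps -> open I -> K `<=` I -> closed K -> mu (~` K) = 0%E ->
  (size s <= n.+1)%N -> ((1 - eps / 2)%:E <= mu [set` s])%E ->
  exists E : set R, [/\ closed E, E `<=` I, at_most_n_components n.+1 E,
    ((1 - eps)%:E <= mu E)%E & controls mu n.+1 I K eps (eps / (2 * n.+1%:R)) E].
Proof.
move=> e0 oI KI clK muK sn mus.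
pose th := eps / (2 * n.+1%:R).
have th0 : 0 < th by rewrite divr_gt0 // mulr_gt0.
pose heavy := [seq x <- s | (th%:E <= mu [set x])%E].
pose light := [seq x <- s | ~~ (th%:E <= mu [set x])%E].
have mseq (l : seq R) : measurable ([set` l] : set (measurableTypeR R)).
  by apply: closed_measurable; exact: closed_seq.
have mlight : (mu [set` light] <= (eps / 2)%:E)%E.
  apply: (le_trans (measure_light_seq mu th light _)).
    move=> x; rewrite mem_filter => /andP[+ _]; rewrite -ltNge; exact: ltW.
  rewrite lee_fin.
  have -> : eps / 2 = n.+1%:R * th by rewrite /th; field; rewrite nat1r pnatr_eq0.
  apply: ler_wpM2r; first exact: ltW.
  by rewrite ler_nat (leq_trans _ sn) // size_filter count_size.
have heavyI : [set` heavy] `<=` I.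
  move=> x /=; rewrite mem_filter => /andP[thx _]; apply: KI; apply: contrapT => nKx.
  move: thx; rewrite leNgt => /negP; apply.
  apply: (@le_lt_trans _ _ (mu (~` K))); last by rewrite muK lte_fin.
  apply: probability_mono; [exact: measurable_set1| |by move=> y ->].
  by apply: open_measurable; exact: closed_openC.
exists [set` heavy]; split.
- exact: closed_seq.
- exact: heavyI.
- apply: (card_image_le_ordinal 0) => g gE; apply: contrapT => inj.
  have : (size [seq g i | i <- iota 0 n.+2] <= size heavy)%N.
    apply: uniq_leq_size.
      rewrite map_inj_in_uniq ?iota_uniq // => i j; rewrite !mem_iota !add0n !ltnS /= => im jm gij.
      case: (ltngtP i j) => // ij; exfalso; apply: inj.
        by exists i, j; rewrite gij.
      by exists j, i; rewrite gij.
    by move=> _ /mapP[i + ->]; rewrite mem_iota /= add0n ltnS => /gE.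
  rewrite size_map size_iota leqNgt => /negP; apply.
  rewrite ltnS (leq_trans _ sn) // size_filter; exact: count_size.
- have ls : (mu (~` [set` s]) <= (eps / 2)%:E)%E by apply/largeE.
  apply/largeE => //; apply: (@le_trans _ _ (mu (~` [set` s] `|` [set` light]))).
    apply: probability_mono; [exact: measurableC|apply: measurableU => //; exact: measurableC|].
    move=> x /= nh; have [xs|xs] := boolP (x \in s); last by left; exact/negP.
    right; rewrite /= mem_filter xs andbT; apply/negP => thx; apply: nh.
    by rewrite mem_filter thx.
  apply: (le_trans (measureU2 _ _ _)) => //; first exact: measurableC.
  by rewrite [eps](_ : _ = eps / 2 + eps / 2) ?EFinD ?leeD //; field.
- move=> C f C1 pf J JE x /= xh; rewrite -/th.
  have Ix := heavyI x xh; have J0 : 0 <= J.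
    by rewrite -lee_fin -JE; apply: integral_ge0 => t _; rewrite lee_fin.
  have CJ : J <= C * J by rewrite ler_peMl.
  have [fx|fx] := eqVneq (f x) 0; first by rewrite fx normr0 mulr0 (le_trans J0).
  have fx0 : 0 < `|f x| by rewrite normr_gt0.
  apply: le_trans CJ.
  have := markov_on mu I f `|f x| (J / `|f x|) oI (polynomial_type_continuous _ _ _ _ _ pf) fx0.
  rewrite JE mulrC divfK ?normr_eq0 // lexx => /(_ isT) h.
  rewrite -ler_pdivlMr // -lee_fin; apply: le_trans h.
  move: xh; rewrite mem_filter => /andP[+ _] => /le_trans; apply.
  apply: probability_mono; first exact: measurable_set1.
    exact: measurable_superlevel oI (polynomial_type_continuous _ _ _ _ _ pf).
  by move=> y /= ->; split.
Qed.

Lemma large_sublevels {R : realType} (mu : probability (measurableTypeR R) R) (K : set R)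
    (e : R) (S : nat -> seq R) (Phi : nat -> R) (m : nat) :
  (forall j, (j < m)%N -> large mu e (K `&` sublevel (S j) (2 * Phi j))) ->
  large mu (m%:R * e) [set t | forall j, (j < m)%N -> (K `&` sublevel (S j) (2 * Phi j)) t].
Proof.
elim: m => [_|m ih lS].
  rewrite (_ : [set t | _] = setT).
    by split; rewrite ?setCT ?measure0 ?mul0r.
  by apply/seteqP; split.
have -> : [set t | forall j, (j < m.+1)%N -> (K `&` sublevel (S j) (2 * Phi j)) t] =
    [set t | forall j, (j < m)%N -> (K `&` sublevel (S j) (2 * Phi j)) t] `&`
    (K `&` sublevel (S m) (2 * Phi m)).
  apply/seteqP; split => [t h|t [h hm] j].
    by split; [move=> j jm; apply: h; exact: leqW|exact: h].
  by rewrite ltnS leq_eqVlt => /orP[/eqP->|/h].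
rewrite -natr1 mulrDl mul1r; apply: largeI; last exact: lS.
by apply: ih => j jm; apply: lS; exact: leqW.
Qed.

(** Since no n.+1 points carry mass 1 - eps / 2, nearly minimal nodes exist in every degree up to
    n.+1. Markov's inequality then provides the large set on which [node_sublevel_bound] needs [f]
    to be small. *)
Lemma diffuse_case {R : realType} (n : nat) (eps : R) : 0 < eps -> eps < 1 ->
  exists2 c : R, 0 < c & forall (mu : probability (measurableTypeR R) R) (I K : set R),
    open_interval I -> K `<=` I -> closed K -> mu (~` K) = 0%E ->
    (forall s : seq R, (size s <= n.+1)%N -> (mu [set` s] < (1 - eps / 2)%:E)%E) ->
    exists E : set R, [/\ closed E, E `<=` I, at_most_n_components n.+1 E,
      ((1 - eps)%:E <= mu E)%E & controls mu n.+1 I K eps c E].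
Proof.
move=> e0 e1; have [A A0 bound] := node_sublevel_bound n eps e0 e1.
(* Chosen so that n + 2 exceptional sets, each of mass at most the largest allowance eta 2^(n+1),
   have total mass at most eps / 2. *)
pose top : R := n.+2%:R * 2 ^+ n.+2.
have top0 : 0 < top by rewrite mulr_gt0 // exprn_gt0.
pose eta := eps / top.
have eta0 : 0 < eta by rewrite divr_gt0.
have top1 : 1 < top.
  by rewrite /top -natrX -natrM ltr1n; apply: (@leq_trans (n.+2 * 1)); rewrite ?leq_mul2l ?expn_gt0 ?muln1.
have eta1 : eta < 1 by rewrite ltr_pdivrMr // mul1r (lt_trans e1).
have etaN : n.+2%:R * (eta * 2 ^+ n.+1) = eps / 2.
  have w0 : n.+2%:R != 0 :> R by rewrite pnatr_eq0.
  have v0 : 2 ^+ n.+1 != 0 :> R by rewrite expf_neq0 // pnatr_eq0.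
  rewrite /eta /top exprS; move: (n.+2%:R : R) (2 ^+ n.+1 : R) w0 v0 => w v w0 v0.
  by field; apply/andP.
have etak k : eta * 2 ^+ (n.+1 - k) <= eta * 2 ^+ n.+1.
  apply: ler_wpM2l; first exact: ltW.
  by apply: ler_weXn2l; [rewrite ler1n|exact: leq_subr].
have etak2 k : eta * 2 ^+ (n.+1 - k) <= eps / 2.
  apply: (le_trans (etak k)); rewrite -etaN ler_peMl ?ler1n //.
  by rewrite mulr_ge0 ?exprn_ge0 // ltW.
exists (eta / (2 * A)); first by rewrite divr_gt0 // mulr_gt0.
move=> mu I K [oI itvI] KI clK muK diffuse.
have eta20 : 0 < eta / 2 by rewrite divr_gt0.
have eta21 : eta / 2 < 1 by lra.
(* Half of [eta] pays for cutting to a segment, the other half for Markov's inequality in [main]. *)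
have [a [b [Ka Kb lK0]]] := large_segment mu K (eta / 2) clK muK eta20 eta21.
set K0 := K `&` `[a, b]%classic in lK0.
have clK0 : closed K0 by apply: closedI => //; exact: interval_closed.
have abI : `[a, b]%classic `<=` I.
  by move=> t; rewrite /= in_itv /= => tab; apply: (itvI a b) => //; exact: KI.
have mus k (s : seq R) : (k <= n.+1)%N -> (size s <= k)%N ->
    (mu [set` s] < (1 - eta * 2 ^+ (n.+1 - k))%:E)%E.
  move=> kn sk; apply: (lt_le_trans (diffuse s (leq_trans sk kn))).
  by rewrite lee_fin lerD2l lerN2.
have lK k : large mu (eta * 2 ^+ (n.+1 - k)) K0.
  apply: large_sub (lK0) => //; first exact: closed_measurable.
  have : 1 <= (2 ^+ (n.+1 - k) : R) by rewrite exprn_ege1 // ler1n.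
  by move: eta0; set w := 2 ^+ _; clear; nra.
pose spec k (SP : seq R * R) := (k <= n.+1)%N ->
  near_minimal mu K0 (eta * 2 ^+ (n.+1 - k)) k SP.1 SP.2.
have /choice[SP SPP] : forall k, exists sp, spec k sp.
  move=> k; rewrite /spec; have [kn|kn] := leqP k n.+1; last by exists ([::], 0).
  have K0ab : K0 `<=` `[a, b]%classic by move=> t [].
  have [S [Phi nm]] := exists_near_minimal mu K0 a b _ k clK0 K0ab (lK k) (mus k ^~ kn).
  by exists (S, Phi).
pose S k := (SP k).1; pose Phi k := (SP k).2.
have nm k : (k <= n.+1)%N -> near_minimal mu K0 (eta * 2 ^+ (n.+1 - k)) k (S k) (Phi k).
  exact: SPP.
pose E := [set t : R | a <= t <= b /\ (level_poly n.+2 S Phi).[t] <= 4 * n.+2%:R].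
have clE : closed E.
  have -> : E = `[a, b]%classic `&` horner (level_poly n.+2 S Phi) @^-1` [set x | x <= 4 * n.+2%:R].
    by apply/seteqP; split => t; rewrite /E /= in_itv.
  apply: closedI; first exact: interval_closed.
  by apply: preimage_closed; [move=> t _; exact: continuous_horner|exact: closed_le].
exists E; split => //.
- by move=> t [tab _]; apply: abI; rewrite /= in_itv.
- apply: level_poly_components; last by have [] := nm n.+1 (leqnn _).
  by move=> k kn; have [_ []] := nm k kn.
- apply/largeE; first exact: closed_measurable.
  suff [] : large mu eps E by [].
  have lB : large mu (n.+2%:R * (eta * 2 ^+ n.+1))
      [set t | forall j, (j < n.+2)%N -> (K0 `&` sublevel (S j) (2 * Phi j)) t].
    apply: large_sublevels => j jn; have [_ _ _ lj _] := nm j jn.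
    by apply: large_sub (lj) => //; case: lj.
  apply: large_sub lB; [exact: closed_measurable| |by rewrite etaN; lra].
  (* Where every N_{S j} is at most 2 Phi j, the n + 2 squares are at most 4 each, which explains
     the level 4 (n + 2). *)
  move=> t h; have [[_ tab] _] := h 0%N isT.
  split; first by move: tab; rewrite /= in_itv.
  rewrite horner_level_poly (le_trans (y := \sum_(j < n.+2) 4)) //; last first.
    by rewrite sumr_const card_ord mulr_natr.
  apply: ler_sum => j _; have [_ tj] := h j (ltn_ord j).
  have [Pj _ _ _ _] := nm j (ltn_ord j).
  rewrite -real_normK ?num_real // normrM normfV (gtr0_norm Pj).
  have : `|(nodal (S j)).[t]| / Phi j <= 2 by rewrite ler_pdivrMr.
  have : 0 <= `|(nodal (S j)).[t]| / Phi j by rewrite divr_ge0 // ltW.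
  by set w := _ / _; clear; nra.
- move=> C f C1 pf J JE t [tab Qt].
  have J0 : 0 <= J.
    by rewrite -lee_fin -JE; apply: integral_ge0 => u _; rewrite lee_fin.
  have Cp : 0 < C by exact: lt_le_trans C1.
  have C0 := ltW Cp.
  have cf := polynomial_type_continuous _ _ _ _ _ pf.
  have Sa : enlargement I K eps a by left; left.
  have [F [M [jF cF FM FC F0]]] := polynomial_type_jet _ _ _ _ _ a (KI _ Ka) Sa C0 pf.
  have main d : 0 < d -> J <= d * (eta / 2) -> `|f t| <= A * C * d.
    move=> d0 Jd; rewrite -F0.
    apply: (bound mu I K a b eta S Phi clK Ka Kb abI (ltW eta0) nm mus F M C d
      (K0 `&` [set u | `|f u| <= d])) => //.
    - by move=> u uab; apply: cF; apply/mem_set; exact: abI.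
    - by move=> u uab; apply: FM; apply: abI; rewrite /= in_itv.
    - by move=> u uab Su; apply: FC => //; apply: abI; rewrite /= in_itv.
    - rewrite [eta](_ : _ = eta / 2 + eta / 2); last by field.
      apply: (large_small_values mu I) => //.
        by move=> u [/KI].
      by rewrite JE lee_fin.
    - exact: ltW.
    - by move=> u [_]; rewrite F0.
  (* When J = 0 the choice d = 2 J / eta is not positive. Any d > 0 is then allowed, and d = |f t| /
     (2 A C) gives |f t| <= |f t| / 2. *)
  have [J1|J1] := leP J 0.
    have Jz : J = 0 by apply/eqP; rewrite eq_le J1.
    have [ft|ft] := leP `|f t| 0.
      have -> : `|f t| = 0 by apply/eqP; rewrite eq_le ft normr_ge0.
      by rewrite Jz !mulr0.
    have AC : 0 < A * C by rewrite mulr_gt0.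
    have := main (`|f t| / (2 * (A * C))).
    rewrite Jz divr_gt0 ?mulr_gt0 // => /(_ isT).
    have d0 : 0 <= `|f t| / (2 * (A * C)) * (eta / 2).
      by apply: mulr_ge0; [apply: divr_ge0 => //; apply: mulr_ge0 => //; exact: ltW|exact: ltW].
    move=> /(_ d0).
    have -> : A * C * (`|f t| / (2 * (A * C))) = `|f t| / 2.
      by field; rewrite !gt_eqF.
    by move: ft; lra.
  have j0 : 0 < 2 * J / eta by apply: divr_gt0 => //; exact: mulr_gt0.
  have := main _ j0.
  have -> : 2 * J / eta * (eta / 2) = J by field; rewrite gt_eqF.
  move=> /(_ (lexx _)) h.
  have k0 : 0 <= eta / (2 * A) by apply/ltW/divr_gt0 => //; exact: mulr_gt0.
  apply: (le_trans (ler_wpM2l k0 h)).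
  have -> : eta / (2 * A) * (A * C * (2 * J / eta)) = C * J by field; rewrite !gt_eqF.
  exact: lexx.
Qed.

Theorem theorem4 (R : realType) (n : nat) (hn : (0 < n)%N)
    (eps : R) (heps0 : 0 < eps) (heps1 : eps < 1) :
  exists2 c : R, 0 < c &
    forall (I K : set R) (mu : probability (measurableTypeR R) R),
      open_interval I -> K `<=` I -> closed K ->
      regular_measure mu -> mu (~` K) = 0%E ->
      exists E : set R,
        [/\ closed E, E `<=` I, at_most_n_components n E,
            ((1 - eps)%:E <= mu E)%E
          & forall (C : R) (f : R -> R), 1 <= C ->
              polynomial_type n (enlargement I K eps) I C f ->
              ((c * C^-1)%:E * ereal_sup [set (`|f t|)%:E | t in E]
                <= \int[mu]_(t in I) (`|f t|)%:E)%E].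
Proof.
case: n hn => // n _.
have [c1 c10 diffuse] := diffuse_case n eps heps0 heps1.
pose c2 := eps / (2 * n.+1%:R).
have c20 : 0 < c2 by rewrite divr_gt0 // mulr_gt0.
have c0 : 0 < Num.min c1 c2 by rewrite lt_min c10.
exists (Num.min c1 c2) => // I K mu oitvI KI clK _ muK.
suff [E [clE EI nE muE [c [cc ctrl]]]] : exists E : set R,
    [/\ closed E, E `<=` I, at_most_n_components n.+1 E, ((1 - eps)%:E <= mu E)%E &
     exists c, Num.min c1 c2 <= c /\ controls mu n.+1 I K eps c E].
  exists E; split => // C f C1 pf.
  have C0 : 0 < C by lra.
  set cm := Num.min c1 c2 in c0 cc *.
  (* An infinite integral makes the inequality trivial, so only a real value [J] calls for
     [ctrl]. *)
  case JE : (\int[mu]_(t in I) (`|f t|)%:E)%E => [J| |]; last 2 first.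
  - exact: leey.
  - have : (0 <= \int[mu]_(t in I) (`|f t|)%:E)%E.
      by apply: integral_ge0 => t _; rewrite lee_fin.
    by rewrite JE.
  have cC0 : 0 < cm * C^-1 by rewrite divr_gt0.
  have sup_le : (ereal_sup [set (`|f t|)%:E | t in E] <= (C * J / cm)%:E)%E.
    apply: ge_ereal_sup => _ [t Et <-]; rewrite lee_fin ler_pdivlMr // mulrC.
    by apply: le_trans (ctrl C f C1 pf J JE t Et); rewrite ler_wpM2r.
  apply: (le_trans (lee_wpmul2l _ sup_le)); first by rewrite lee_fin ltW.
  by rewrite -EFinM lee_fin (_ : _ * _ = J) //; field; rewrite !gt_eqF.
(* Dichotomy: either some n.+1 points carry mass at least 1 - eps / 2, or no such points exist and
   the polynomial construction applies. The constant is the smaller of the two obtained. *)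
have [[s [sn mus]]|nos] := pselect (exists s : seq R, (size s <= n.+1)%N /\
    ((1 - eps / 2)%:E <= mu [set` s])%E).
  have [E [clE EI nE muE ctrl]] := atomic_case mu n I K eps s heps0 oitvI.1 KI clK muK sn mus.
  by exists E; split => //; exists c2; rewrite ge_min lexx orbT.
have [s sn|E [clE EI nE muE ctrl]] := diffuse mu I K oitvI KI clK muK.
  by rewrite ltNge; apply/negP => mus; apply: nos; exists s.
by exists E; split => //; exists c1; rewrite ge_min lexx.
Qed.
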